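(* (a) Let $\sigma>0$ and $\mathcal B_\sigma=\{f\in\mathcal V^1:\operatorname{Var}(f')\le\sigma\}$. Let $T$ be the non-adaptive trapezoidal algorithm on $\mathcal B_\sigma$ defined in the context. Then for every $\varepsilon>0$ and $f\in\mathcal B_\sigma$, $\bigl|\int_0^1f(x)\,dx-T(f,\varepsilon)\bigr|\le\varepsilon$, and the cost of this algorithm is $\bigl\lceil\sqrt{\sigma/(8\varepsilon)}\,\bigr\rceil+1$, regardless of the size of $\operatorname{Var}(f')$. (b) Let $\tau\ge2$ and let $T$ be the adaptive trapezoidal algorithm with initial cone constant $\tau$ defined in the context. Then for every $\varepsilon>0$ and $f\in\mathcal C_\tau$, $\bigl|\int_0^1f(x)\,dx-T(f,\varepsilon)\bigr|\le\varepsilon$. Moreover, the cost is bounded as follows: $$\max\!\left(\left\lceil\tfrac{\tau+1}{2}\right\rceil,\left\lceil\sqrt{\tfrac{\operatorname{Var}(f')}{8\varepsilon}}\,\right\rceil\right)+1\le\max\!\left(\left\lceil\tfrac{\tau+1}{2}\right\rceil,\left\lceil\sqrt{\tfrac{\tau\|f'-f(1)+f(0)\|_1}{8\varepsilon}}\,\right\rceil\right)+1\le\operatorname{cost}(T,f,\varepsilon)$$ $$\le\sqrt{\frac{\tau\|f'-f(1)+f(0)\|_1}{2\varepsilon}}+\tau+4\le\sqrt{\frac{\tau\operatorname{Var}(f')}{4\varepsilon}}+\tau+4 .$$ The algorithm is computationally stable: for each of the two functionals $|f|_*=\|f'-f(1)+f(0)\|_1$ and $|f|_*=\operatorname{Var}(f')$,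 $$\sup_{\varepsilon,s>0}\frac{\sup\{\operatorname{cost}(T,f,\varepsilon):f\in\mathcal C_\tau,\ |f|_*\le s\}}{\max\bigl(1,\inf\{\operatorname{cost}(T,f,\varepsilon):f\in\mathcal C_\tau,\ |f|_*\ge s\}\bigr)}<\infty .$$
   Context: **Spaces.** $\operatorname{Var}(u)=\sup\sum_{i=1}^n|u(x_i)-u(x_{i-1})|$ over all $n\in\mathbb N$ and $0=x_0<\dots<x_n=1$. $\mathcal V^1=\{f\in C[0,1]:\operatorname{Var}(f')<\infty\}$; here $f$ is absolutely continuous, $f'$ is its almost-everywhere defined derivative, and $\operatorname{Var}(f')$ is the smallest variation among functions on $[0,1]$ equal to $f'$ almost everywhere (so continuous piecewise linear functions belong to $\mathcal V^1$). $\|u\|_1=\int_0^1|u|\,dx$. In $\|f'-f(1)+f(0)\|_1$ the number $f(1)-f(0)$ is subtracted as a constant function. For $\tau>0$, $\mathcal C_\tau=\{f\in\mathcal V^1:\operatorname{Var}(f')\le\tau\|f'-f(1)+f(0)\|_1\}$. **Cost.** The cost of an algorithm is the number of function values of $f$ it uses. **Trapezoidal rule and auxiliary quantities.** For $n\ge2$ let $x_i=(i-1)/(n-1)$, $i=1,\dots,n$, and $$T_n(f)=\frac1{2n-2}\bigl[f(x_1)+2f(x_2)+\dots+2f(x_{n-1})+f(x_n)\bigr],$$ $$\widetilde F_n(f)=\sum_{i=1}^{n-1}\left|f(x_{i+1})-f(x_i)-\frac{f(1)-f(0)}{n-1}\right|,\qquad F_n(f)=(n-1)\sum_{i=1}^{n-2}|f(x_i)-2f(x_{i+1})+f(x_{i+2})|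 .$$ **Non-adaptive algorithm on $\mathcal B_\sigma$.** With $h(n)=1/(8(n-1)^2)$, $n\ge2$, choose $n=\min\{k\ge2:h(k)\le\varepsilon/\sigma\}$ and return $T(f,\varepsilon)=T_n(f)$. **Adaptive algorithm.** Let $\tau\ge2$ be the cone constant, $i=1$, $n_1=\lceil(\tau+1)/2\rceil+1$. For $\varepsilon>0$ and input $f$: - Stage 1. Compute $\widetilde F_{n_i}(f)$ and $F_{n_i}(f)$. - Stage 2. Compute $\tau_{\min,n_i}=F_{n_i}(f)/\bigl(\widetilde F_{n_i}(f)+F_{n_i}(f)/(2n_i-2)\bigr)$ (with $0/0=0$). If $\tau\ge\tau_{\min,n_i}$ go to Stage 3. Otherwise replace $\tau$ by $2\tau_{\min,n_i}$; then if $n_i\ge(\tau+1)/2$ go to Stage 3; otherwise set $n_{i+1}=1+(n_i-1)\lceil(\tau+1)/(2n_i-2)\rceil$, increase $i$ by 1, and go to Stage 1. - Stage 3. If $\widetilde F_{n_i}(f)\le 4\varepsilon(n_i-1)(2n_i-2-\tau)/\tau$, return $T(f,\varepsilon)=T_{n_i}(f)$ and stop. Otherwise set $$n_{i+1}=1+(n_i-1)\max\left\{2,\left\lceil\frac1{n_i-1}\sqrt{\frac{\tau\widetilde F_{n_i}(f)}{8\varepsilon}}\,\right\rceil\right\},$$ increase $i$ by 1, and go to Stage 1. Since the nodes are nested, $\operatorname{cost}(T,f,\varepsilon)$ is the final value $n_i$. In the claim, $\tau$ denotes the initial cone constant. The infimum of the empty set is $+\infty$ (and a finite number divided by $+\infty$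 is $0$). *)

(* Defs.v *)
From mathcomp Require Import all_boot all_order all_algebra.
From mathcomp Require Import all_classical all_reals all_analysis.
Import Order.TTheory GRing.Theory Num.Theory.
Import numFieldNormedType.Exports.

Set Implicit Arguments.
Unset Strict Implicit.
Unset Printing Implicit Defensive.

Local Open Scope classical_set_scope.
Local Open Scope ring_scope.

(* A function on [0, 1] is represented by a function R -> R of which only the *)
(* restriction to [0, 1] matters: everything below depends on f through its   *)
(* values on [0, 1] and through derive1 f up to a null subset of [0, 1].      *)

Section function_spaces.
Context {R : realType}.
Implicit Types f : R -> R.

Definition absolutely_continuous f : Prop :=
  forall e : R, 0 < e -> exists2 d : R, 0 < d &
    forall (n : nat) (a b : 'I_n -> R),
      (forall i, [/\ 0 <= a i, a i <= b i & b i <= 1]) ->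
      trivIset [set: 'I_n] (fun i => `]a i, b i[%classic) ->
      \sum_i (b i - a i) < d ->
      \sum_i `|f (b i) - f (a i)| < e.

(* Var(f'), the variation being minimised over the representatives of the     *)
(* almost everywhere class of f' on [0, 1].                                   *)
Definition deriv_var f : \bar R :=
  ereal_inf [set total_variation 0 1 g
            | g in [set g : R -> R | \forall x \ae lebesgue_measure,
                              x \in `[0, 1] -> g x = derive1 f x]].

Definition norm1 (u : R -> R) : \bar R :=
  (\int[lebesgue_measure]_(x in `[0%R, 1%R]) `|u x|%:E)%E.

(* || f' - f(1) + f(0) ||_1 *)
Definition deriv_dev f : \bar R := norm1 (fun x => derive1 f x - (f 1 - f 0)).

Definition V1 : set (R -> R) :=
  [set f : R -> R | [/\ {within `[0, 1], continuous f},
                       absolutely_continuous f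
                     & (deriv_var f < +oo)%E]].

Definition ball_var (sigma : R) : set (R -> R) :=
  [set f : R -> R | V1 f /\ (deriv_var f <= sigma%:E)%E].

Definition cone (tau : R) : set (R -> R) :=
  [set f : R -> R | V1 f /\ (deriv_var f <= tau%:E * deriv_dev f)%E].

Definition integral01 f : R := \int[lebesgue_measure]_(x in `[0, 1]) f x.

End function_spaces.

(* The ceiling as a natural number; used for nonnegative arguments only. *)
Definition ceiln {R : realType} (x : R) : nat := `|Num.ceil x|%N.

Section trapezoidal_rule.
Context {R : realType}.
Implicit Types (f : R -> R) (n : nat).

(* The nodes are numbered from 1 to n. *)
Definition node n (i : nat) : R := i.-1%:R / n.-1%:R.

Definition trapezoid n f : R :=
  (f (node n 1) + 2 * (\sum_(2 <= i < n) f (node n i)) + f (node n n))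
  / (2 * n%:R - 2).

Definition Ftilde n f : R :=
  \sum_(1 <= i < n)
    `|f (node n i.+1) - f (node n i) - (f 1 - f 0) / n.-1%:R|.

Definition Fsecond n f : R :=
  n.-1%:R * \sum_(1 <= i < n.-1)
    `|f (node n i) - 2 * f (node n i.+1) + f (node n i.+2)|.

End trapezoidal_rule.

Section nonadaptive_algorithm.
Context {R : realType}.

(* The error of the rule with n nodes is at most error_factor n * Var(f'). *)
Definition error_factor (n : nat) : R := (8 * n.-1%:R ^+ 2)^-1.

Lemma nonadaptive_exists (sigma eps : R) : 0 < sigma -> 0 < eps ->
  exists k : nat, (2 <= k)%N && (error_factor k <= eps / sigma).
Proof.
move=> sigma0 eps0; pose m := Num.bound (sigma / eps).
exists m.+2; rewrite /error_factor /=.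
have se0 : 0 < sigma / eps by exact: divr_gt0.
rewrite -[leRHS]invf_div lef_pV2 ?posrE ?mulr_gt0 ?exprn_gt0 ?ltr0n ?invr_gt0//.
have hm : sigma / eps <= m.+1%:R.
  apply: (@le_trans _ _ m%:R); last by rewrite ler_nat.
  by apply/ltW/archi_boundP/ltW.
by rewrite (le_trans hm)// -natrX -natrM ler_nat -mulnn mulnA leq_pmull.
Qed.

(* Since the n nodes are distinct, this is also the cost. *)
Definition nonadaptive_cost (sigma eps : R)
    (sigma0 : 0 < sigma) (eps0 : 0 < eps) : nat :=
  ex_minn (nonadaptive_exists sigma0 eps0).

Definition nonadaptive (sigma eps : R) (sigma0 : 0 < sigma) (eps0 : 0 < eps)
    (f : R -> R) : R :=
  trapezoid (nonadaptive_cost sigma0 eps0) f.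

End nonadaptive_algorithm.

Section adaptive_algorithm.
Context {R : realType} (eps : R) (f : R -> R).
Implicit Types (tau : R) (n N : nat).

(* Field division gives x / 0 = 0. *)
Definition tau_min n : R :=
  Fsecond n f / (Ftilde n f + Fsecond n f / (2 * n%:R - 2)).

(* What one pass through the stages leads to: stop with n nodes, or go back   *)
(* to Stage 1 with the given cone constant and number of nodes.               *)
Variant outcome := Stop of nat | Continue of R & nat.

Definition stage3 tau n : outcome :=
  if Ftilde n f <= 4 * eps * (n%:R - 1) * (2 * n%:R - 2 - tau) / tau
  then Stop n
  else Continue tau
    (1 + n.-1 * maxn 2
       (ceiln ((n%:R - 1)^-1 * Num.sqrt (tau * Ftilde n f / (8 * eps)))))%N.

Definition pass tau n : outcome :=
  if tau_min n <= tau then stage3 tau n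
  else
    let tau' := 2 * tau_min n in
    if (tau' + 1) / 2 <= n%:R then stage3 tau' n
    else Continue tau' (1 + n.-1 * ceiln ((tau' + 1) / (2 * n%:R - 2)))%N.

(* adaptive_run tau n N: entering Stage 1 with cone constant tau and n nodes, *)
(* the algorithm stops after finitely many passes, with N nodes.              *)
Inductive adaptive_run tau n N : Prop :=
| Run_stop of pass tau n = Stop N
| Run_continue tau' n' of
    pass tau n = Continue tau' n' & adaptive_run tau' n' N.

Lemma adaptive_run_unique tau n N N' :
  adaptive_run tau n N -> adaptive_run tau n N' -> N = N'.
Proof.
move=> r; elim: r N' => {tau n N}.
- move=> tau n N e N' []; first by rewrite e => -[].
  by move=> tau' n'; rewrite e.
- move=> tau n N tau' n' e _ IH N' []; first by rewrite e.
  by move=> tau'' n''; rewrite e => -[<- <-]; exact: IH.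
Qed.

End adaptive_algorithm.

(* On input f, starting with cone constant tau, the algorithm stops with N    *)
(* nodes; its answer is then trapezoid N f.                                   *)
Definition adaptive_stops {R : realType} (tau eps : R) (f : R -> R) (N : nat) :=
  adaptive_run eps f tau (ceiln ((tau + 1) / 2) + 1) N.

(* By adaptive_run_unique this is the infimum of at most one number: it is    *)
(* the final number of nodes, and +oo if the algorithm does not stop.         *)
Definition adaptive_cost {R : realType} (tau eps : R) (f : R -> R) : \bar R :=
  ereal_inf [set N%:R%:E | N in adaptive_stops tau eps f].

(* The inverse of +oo in \bar R is 0. *)
Definition stability_ratio {R : realType} (tau : R) (seminorm : (R -> R) -> \bar R)
    (eps s : R) : \bar R :=
  (ereal_sup [set adaptive_cost tau eps f
             | f in [set f : R -> R | cone tau f /\ seminorm f <= s%:E]]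
   / maxe 1 (ereal_inf [set adaptive_cost tau eps f
                       | f in [set f : R -> R | cone tau f /\ s%:E <= seminorm f]]))%E.

Definition computationally_stable {R : realType} (tau : R)
    (seminorm : (R -> R) -> \bar R) : Prop :=
  (ereal_sup [set stability_ratio tau seminorm es.1 es.2
             | es in [set es : R * R | (0 < es.1)%R /\ (0 < es.2)%R]] < +oo)%E.

(* Main.v *)
Require Import Defs.
From mathcomp Require Import all_boot all_order all_algebra.
From mathcomp Require Import all_classical all_reals all_analysis.
From mathcomp Require Import measurable_realfun ring lra.
From HB Require Import structures.
Import Order.TTheory GRing.Theory Num.Theory.
Import numFieldNormedType.Exports.

Set Implicit Arguments.
Unset Strict Implicit.
Unset Printing Implicit Defensive.

Local Open Scope classical_set_scope.
Local Open Scope ring_scope.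

(* If f is absolutely continuous, then so is x |-> TV 0 x f, and f is the     *)
(* difference of two nondecreasing absolutely continuous functions. Their     *)
(* Lebesgue-Stieltjes measures are absolutely continuous, so by Radon-Nikodym *)
(* and Lebesgue differentiation f is the integral of every function g that    *)
(* equals f' almost everywhere. On a cell of length h on which such a g has   *)
(* variation v, the values of g lie in an interval of length v, whence the    *)
(* trapezoidal error is at most v h^2 / 8 and the mean deviation of g at most *)
(* v / 2. Summing over the cells and minimising over g, with V = Var(f'),     *)
(* A = ||f' - f(1) + f(0)||_1 and n = m + 1 nodes,                            *)
(*   |error| <= V / (8 m^2), F~ <= A <= F~ + V / (2 m), F <= V, A <= V / 2.   *)
(* In the cone V <= tau A these inequalities give tau_min <= tau, so tau is   *)
(* never increased, and the stopping test at m + 1 nodes implies both         *)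
(* tau A <= 8 eps m^2 and |error| <= eps. A failed test at m + 1 nodes gives  *)
(* m (m - tau / 2) < tau A / (8 eps), which bounds the next number of nodes.  *)

(** * Absolute continuity and total variation *)

(** The cone condition turns computable data into bounds on quantities that no sampling reveals.
    With m cells, F~ falls short of A by at most V / (2 m), and V <= tau A, so A (1 - tau / (2 m))
    <= F~. Once 2 m > tau, F~ therefore controls A, hence V, hence the trapezoidal error V / (8
    m^2). The same computation shows that the cone constant is never revised ([tau_min_le]).

    Put S = sqrt(tau A / (8 eps)). A passed test forces S <= m ([stop_bound]), which gives both the
    error guarantee and the lower bound on the cost. A failed test forces m <= S + tau / 2, and then
    the next m is at most 2 S + tau ([next_bound]). Since m at least doubles after each failure, the
    run ends ([adaptive_run_exists]). The cost thus lies between S and a multiple of S plus a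
    constant, which is stability for A. On the cone V / tau <= A <= V / 2, so for V only the
    constants change ([stable_of_bounds]).

    The measure theory serves one fact: f is the integral of each representative g of f' of bounded
    variation ([derivative_representative_integral]). Since Var(f') is an infimum over such g, each
    estimate is proved for every g as a lower bound on its variation and then passes to the infimum
    ([V1_bounds]). *)

Section absolute_continuity.
Context {R : realType}.
Implicit Types (f : R -> R) (L : seq (R * R)).

Definition nonoverlapping (p q : R * R) := (p.2 <= q.1) || (q.2 <= p.1).

Definition subpartition L :=
  all (fun p => [&& 0 <= p.1, p.1 <= p.2 & p.2 <= 1]) L
  && pairwise nonoverlapping L.

Lemma nonoverlappingC p q : nonoverlapping p q = nonoverlapping q p.
Proof. by rewrite /nonoverlapping orbC. Qed.

(** Lists replace indexed families so that an interval can be exchanged for the cells of a partition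
    by concatenation. *)
Lemma absolutely_continuous_seq f : absolutely_continuous f ->
  forall e, 0 < e -> exists2 d, 0 < d & forall L, subpartition L ->
    \sum_(p <- L) (p.2 - p.1) < d -> \sum_(p <- L) `|f p.2 - f p.1| < e.
Proof.
move=> acf e e0; have [d d0 fd] := acf e e0;
  exists d => // L /andP[/allP L01 Ldis].
rewrite !(big_nth (0, 0)) !big_mkord => Ld.
apply: (fd _ (fun i => (nth (0, 0) L i).1) (fun i => (nth (0, 0) L i).2)) => //.
  by move=> i; have /and3P := L01 _ (mem_nth (0, 0) (ltn_ord i)).
have key (i j : nat) x : (i < j < size L)%N ->
    (nth (0, 0) L i).1 < x < (nth (0, 0) L i).2 ->
    (nth (0, 0) L j).1 < x < (nth (0, 0) L j).2 -> False.
  move=> /andP[ij jL] /andP[a1 b1] /andP[a2 b2].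
  have := pairwiseP (0, 0) Ldis; move=> /(_ i j).
  rewrite !inE jL (ltn_trans ij jL) => /(_ isT isT ij) /orP[]; lra.
apply/trivIsetP => i j _ _ ij; rewrite -subset0 => x /=.
rewrite !in_itv/= => -[xi xj].
move: ij; rewrite neq_lt => /orP[] ij.
  by apply: (key i j x) => //; rewrite (ltn_ord j) andbT.
by apply: (key j i x) => //; rewrite (ltn_ord i) andbT.
Qed.

Fixpoint cells (a : R) (s : seq R) : seq (R * R) :=
  if s is x :: s' then (a, x) :: cells x s' else [::].

Lemma cells_sub a s p : path <%O a s -> p \in cells a s ->
  [&& a <= p.1, p.1 <= p.2 & p.2 <= last a s].
Proof.
elim: s a p => //= x s IH a p /andP[ax xs]; rewrite inE => /predU1P[->/=|ps].
  rewrite lexx (ltW ax)/=; have := itv_partition_le (conj xs (eqxx _)).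
  by [].
have /and3P[xp -> ->] := IH _ _ xs ps.
by rewrite (le_trans (ltW ax) xp).
Qed.

Lemma cells_pairwise a s : path <%O a s -> pairwise nonoverlapping (cells a s).
Proof.
elim: s a => //= x s IH a /andP[ax xs]; rewrite IH// andbT.
apply/allP => p /(cells_sub xs) /andP[xp _].
by rewrite /nonoverlapping/= xp.
Qed.

Lemma sum_cells a s : \sum_(p <- cells a s) (p.2 - p.1) = last a s - a.
Proof.
elim: s a => [|x s IH] a /=; first by rewrite big_nil subrr.
rewrite big_cons IH/=; ring.
Qed.

Lemma variation_cells a b f s : itv_partition a b s ->
  variation a b f s = \sum_(p <- cells a s) `|f p.2 - f p.1|.
Proof.
move=> abs; rewrite variation_zip//; elim: s a {abs} => [|x s IH] a /=.
  by rewrite !big_nil.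
by rewrite !big_cons IH.
Qed.

Local Notation TV := (@total_variation R).

(** Partitioning the intervals of [L] keeps them nonoverlapping and preserves their total length, so
    the [d] that works for increments works for every refinement. Taking suprema turns the strict
    bound into a weak one. *)
Lemma absolutely_continuous_total_variation f : absolutely_continuous f ->
  forall e, 0 < e -> exists2 d, 0 < d & forall L, subpartition L ->
    \sum_(p <- L) (p.2 - p.1) < d ->
    (\sum_(p <- L) TV p.1 p.2 f <= e%:E)%E.
Proof.
move=> acf e e0; have [d d0 fd] := absolutely_continuous_seq acf e0.
exists d => //.
(* The intervals are replaced one at a time by the cells of a partition,      *)
(* which avoids choosing near-optimal partitions simultaneously.              *)
have gen L2 : forall L1, subpartition (L1 ++ L2) ->
    \sum_(p <- L1 ++ L2) (p.2 - p.1) < d ->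
    ((\sum_(p <- L1) `|f p.2 - f p.1|)%:E + \sum_(p <- L2) TV p.1 p.2 f
       <= e%:E)%E.
  elim: L2 => [|p L2 IH] L1.
    by rewrite cats0 big_nil adde0 lee_fin => H1 H2; apply/ltW/fd.
  move=> sub Ld.
  have p01 : [&& 0 <= p.1, p.1 <= p.2 & p.2 <= 1].
    move/andP: (sub) => [/allP + _]; apply.
    by rewrite mem_cat inE eqxx orbT.
  (* Finiteness allows this sum to be moved across the inequality in the extended reals; it comes
     from the induction hypothesis with empty prefix. *)
  have L2p : (\sum_(q <- L2) TV q.1 q.2 f)%E \is a fin_num.
    rewrite fin_real//; apply/andP; split.
      rewrite (lt_le_trans (ltNyr 0))// big_seq; apply: sume_ge0 => q qL2.
      apply: total_variation_ge0; move/andP: (sub) => [/allP + _].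
      move=> /(_ q); rewrite mem_cat inE qL2 !orbT => /(_ isT).
      by case/and3P.
    have sub' : subpartition ([::] ++ L2).
      move: sub; rewrite /subpartition all_cat pairwise_cat/=.
      by move=> /andP[/andP[_ /andP[_ ->]]] /and4P[_ _ _ ->].
    have := IH [::] sub'.
    rewrite big_nil add0e => H; apply: le_lt_trans (H _) (ltry e).
    apply: le_lt_trans Ld; rewrite /= big_cat big_cons/=.
    have : 0 <= \sum_(p <- L1) (p.2 - p.1).
      rewrite big_seq; apply: sumr_ge0 => q qL1; rewrite subr_ge0.
      move/andP: (sub) => [/allP + _].
      by move=> /(_ q); rewrite mem_cat qL1 => /(_ isT) /and3P[].
    move/and3P: p01 => [_ + _]; lra.
  rewrite big_cons addeCA -leeBrDr//; last by rewrite fin_numD.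
  apply: ge_ereal_sup => _ /= [_ [s ps <-] <-].
  rewrite leeBrDr ?fin_numD// addeA.
  have [pth /eqP lst] := ps.
  rewrite (variation_cells _ ps) -EFinD -big_cat/=; apply: IH.
  - have cs q : q \in cells p.1 s -> [&& p.1 <= q.1, q.1 <= q.2 & q.2 <= p.2].
      by move/(cells_sub pth); rewrite lst.
    have dcs q r : q \in cells p.1 s -> nonoverlapping p r ->
      nonoverlapping q r.
      move=> /cs /and3P[? ? ?]; rewrite /nonoverlapping => /orP[?|?].
        by apply/orP; left; lra.
      by apply/orP; right; lra.
    move: sub; rewrite /subpartition !all_cat !pairwise_cat/=.
    move=> /andP[/and3P[-> _ ->]] /and4P[al1 -> al2 ->].
    rewrite cells_pairwise//= !andbT.
    apply/andP; split; first by apply/allP => q /cs; move: p01; lra.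
    have al1' : allrel nonoverlapping L1 L2.
      by move: al1; rewrite allrel_consr => /andP[_].
    have al1p q : q \in L1 -> nonoverlapping p q.
      move: al1; rewrite allrel_consr => /andP[/allP H _] /H.
      by rewrite nonoverlappingC.
    rewrite allrel_catl al1' /= andbT; apply/andP; split.
      by apply/allrelP => x y xc yL2; apply: dcs xc _; move/allP : al2; exact.
    apply/allrelP => x y xc yL1; apply: dcs xc _; exact: al1p.
  - by move: Ld; rewrite !big_cat/= big_cons sum_cells lst; lra.
by move=> L subL Ld; have := gen L [::] subL Ld; rewrite big_nil add0e.
Qed.

(** An interval shorter than the [d] belonging to the bound 1 has variation at most 1, and finitely
    many steps of such a length [h] exhaust [0, 1]. *)
Lemma absolutely_continuous_bounded_variation f : absolutely_continuous f ->
  bounded_variation 0 1 f.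
Proof.
move=> acf; apply/bounded_variationP; first exact: ler01.
have [d d0 fd] := absolutely_continuous_total_variation acf ltr01.
pose h := Num.min (d / 2) 1.
have h0 : 0 < h by rewrite lt_min divr_gt0//= ltr01.
have hd : h < d by rewrite gt_min ltr_pdivrMr// ltr_pMr// ltr1n.
suff key n x : x <= 1 -> x <= n%:R * h -> 0 <= x -> TV 0 x f \is a fin_num.
  apply: (key (Num.bound h^-1)) => //; rewrite -ler_pdivrMr// mul1r.
  by apply/ltW/archi_boundP; rewrite invr_ge0 ltW.
elim: n x => [|n IH] x x1 xn x0.
  have -> : x = 0 by apply/eqP; rewrite eq_le x0 andbT (le_trans xn)// mul0r.
  by rewrite total_variationxx.
have [xh|hx] := leP x h.
  have := fd [:: (0, x)]; rewrite /subpartition/= !big_seq1/= lexx x0 x1/=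
    subr0.
  move=> /(_ isT (le_lt_trans xh hd)) Hx.
  by rewrite ge0_fin_numE ?total_variation_ge0// (le_lt_trans Hx)// ltry.
have xh0 : 0 <= x - h by lra.
have xhx : x - h <= x by lra.
have IHx : TV 0 (x - h) f \is a fin_num.
  apply: IH => //; first by rewrite (le_trans xhx).
  by move: xn; rewrite -natr1 mulrDl mul1r; lra.
rewrite (total_variationD f xh0 xhx) fin_numD IHx/=.
have := fd [:: (x - h, x)]; rewrite /subpartition/= !big_seq1/= xh0 xhx x1/=.
have -> : x - (x - h) = h by ring.
move=> /(_ isT hd) Hx.
by rewrite ge0_fin_numE ?total_variation_ge0// (le_lt_trans Hx)// ltry.
Qed.

End absolute_continuity.

(** * Absolutely continuous functions as integrals *)

Section density.
Context {R : realType}.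
Notation mu := (@lebesgue_measure R).

(* The alternative p = (0, 0), used when the intersection is empty, keeps the *)
(* hulls of disjoint intervals nonoverlapping.                               *)
Lemma open_interval_hull (J : set R) : open J -> is_interval J ->
  exists p : R * R, [/\ [&& 0 <= p.1, p.1 <= p.2 & p.2 <= 1],
    p = (0, 0) \/ p.1 < p.2, J `&` `]0, 1] `<=` `]p.1, p.2]
    & `]p.1, p.2[ `<=` J `&` `]0, 1]].
Proof.
move=> oJ iJ; have [->|/set0P[x Kx]] := eqVneq (J `&` `]0, 1]) set0.
  exists (0, 0); split => //=; first by rewrite lexx ler01.
    by left.
  by rewrite set_itvoo0.
set K := J `&` _ in Kx *.
have K01 y : K y -> 0 < y <= 1 by move=> [_]; rewrite /= in_itv.
have lK : has_inf K by split; [exists x|exists 0 => y /K01 /andP[/ltW]].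
have uK : has_sup K by split; [exists x|exists 1 => y /K01 /andP[]].
have infK y : K y -> inf K < y.
  move=> Ky; have [Jy _] := Ky; have /andP[y0 y1] := K01 _ Ky.
  have /nbhs_ballP[e /= e0 eJ] := oJ _ Jy.
  (* [z] is a point of [K] to the left of [y]: near enough to stay in the open set [J], and
     positive. Hence the infimum of [K] is not attained and the hull may be open on the left. *)
  pose z := Num.max (y - e / 2) (y / 2).
  have zy : z < y by rewrite gt_max; apply/andP; split; lra.
  apply: (le_lt_trans _ zy); apply: ge_inf; first by case: lK.
  have ze : y - e / 2 <= z by rewrite le_max lexx.
  have z0 : y / 2 <= z by rewrite le_max lexx orbT.
  split.
    by apply: eJ; rewrite /ball/= gtr0_norm; lra.
  by rewrite /= in_itv/=; apply/andP; split; lra.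
have supK y : K y -> y <= sup K by move=> Ky; apply: ub_le_sup => //; case: uK.
have inf0 : 0 <= inf K.
  by apply: lb_le_inf; [exists x|move=> y /K01 /andP[/ltW]].
have sup1 : sup K <= 1 by apply: ge_sup; [exists x|move=> y /K01 /andP[]].
have ltK : inf K < sup K by exact: lt_le_trans (infK _ Kx) (supK _ Kx).
exists (inf K, sup K); split => /=.
- by rewrite inf0 sup1 (ltW ltK).
- by right.
- by move=> y Ky; rewrite /= in_itv/= infK//= supK.
- move=> y; rewrite /= in_itv/= => /andP[iy ys].
  have [a Ka ay] := inf_lt (proj1 lK) iy.
  have [b Kb yb] := sup_gt (proj1 uK) ys.
  have /andP[a0 _] := K01 _ Ka; have /andP[_ b1] := K01 _ Kb.
  split; last by rewrite /= in_itv/=; apply/andP; split; lra.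
  by apply: (iJ a b); [case: Ka|case: Kb|rewrite (ltW ay) (ltW yb)].
Qed.

Lemma lebesgue_stieltjes_itvoc (F : cumulative R R) (a b : R) : a <= b ->
  lebesgue_stieltjes_measure F (`]a, b]%classic : set R) = (F b - F a)%:E.
Proof.
move=> ab; rewrite /lebesgue_stieltjes_measure /measure_extension/=.
by rewrite measurable_mu_extE/= ?wlength_itv_bnd//; exact: is_ocitv.
Qed.

(** A null set lies in an open set of measure less than [d]. Finitely many of its component
    intervals, cut to ]0, 1], have nonoverlapping hulls of total length below [d], so their
    [F]-increments sum to at most [e]; countable additivity passes to all components. *)
Lemma lebesgue_stieltjes_null (F : cumulative R R) :
  (forall e, 0 < e -> exists2 d, 0 < d & forall L, subpartition L ->
    \sum_(p <- L) (p.2 - p.1) < d -> \sum_(p <- L) (F p.2 - F p.1) <= e) ->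
  forall A : set R, measurable A -> mu A = 0%E ->
    lebesgue_stieltjes_measure F (A `&` `]0, 1]) = 0%E.
Proof.
move=> acF A mA A0.
apply/eqP; rewrite eq_le measure_ge0 andbT; apply/lee_addgt0Pr => e e0.
rewrite add0e; have [d d0 Fd] := acF e e0.
have Aoo : (mu A < +oo)%E by rewrite A0.
have [U [oU AU Ud]] := lebesgue_regularity_outer mA Aoo d0.
have mU : measurable U by exact: open_measurable.
have mD : measurable (U `\` A) by exact: measurableD.
have {}Ud : (mu U < d%:E)%E.
  rewrite -(setDUK AU); apply: le_lt_trans Ud.
  rewrite -[leRHS]add0e -A0; apply: measureU2; [exact: mA|exact: mD].
pose J := open_disjoint_itv oU.
have /choice[p pJ] : forall k, exists p : R * R, [/\
    [&& 0 <= p.1, p.1 <= p.2 & p.2 <= 1],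
    p = (0, 0) \/ p.1 < p.2, J k `&` `]0, 1] `<=` `]p.1, p.2]
    & `]p.1, p.2[ `<=` J k `&` `]0, 1]].
  move=> k; apply: open_interval_hull; first exact: open_disjoint_itv_open.
  exact: open_disjoint_itv_is_interval.
have mJ k : measurable (J k).
  by apply: open_measurable; exact: open_disjoint_itv_open.
have mJI k : measurable (J k `&` `]0, 1]) by exact: measurableI.
have tJ : trivIset setT J by exact: open_disjoint_itv_trivIset.
have subL n : subpartition [seq p k | k <- iota 0 n].
  rewrite /subpartition all_map; apply/andP; split.
    by apply/allP => k _ /=; have [] := pJ k.
  rewrite pairwise_map.
  have : pairwise ltn (iota 0 n) by rewrite -sorted_pairwise
    ?iota_ltn_sorted//; exact: ltn_trans.
  apply: sub_pairwise => i j /= ij.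
  have [i01 i0 _ iJ] := pJ i; have [j01 j0 _ jJ] := pJ j.
  rewrite /nonoverlapping; case: i0 => [->/=|pi].
    by apply/orP; left; case/and3P: j01.
  case: j0 => [->/=|pj]; first by apply/orP; right; case/and3P: i01.
  apply/negPn/negP; rewrite negb_or -!ltNge => /andP[ji ij'].
  (* If two hulls overlapped, the midpoint of the overlap would lie in two disjoint components. *)
  pose a := Num.max (p i).1 (p j).1; pose b := Num.min (p i).2 (p j).2.
  have ai : (p i).1 <= a by rewrite le_max lexx.
  have aj : (p j).1 <= a by rewrite le_max lexx orbT.
  have bi : b <= (p i).2 by rewrite ge_min lexx.
  have bj : b <= (p j).2 by rewrite ge_min lexx orbT.
  have ab : a < b by rewrite lt_min !gt_max pi pj ji ij'.
  have [ix _] : (J i `&` `]0, 1]) ((a + b) / 2).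
    by apply: iJ; rewrite /= in_itv/=; apply/andP; split; lra.
  have [jx _] : (J j `&` `]0, 1]) ((a + b) / 2).
    by apply: jJ; rewrite /= in_itv/=; apply/andP; split; lra.
  have ij0 : i = j by apply: (tJ i j Logic.I Logic.I); exists ((a + b) / 2).
  by rewrite ij0 ltnn in ij.
have nuU : (lebesgue_stieltjes_measure F (U `&` `]0%R, 1%R]) <= e%:E)%E.
  rewrite (open_disjoint_itv_bigcup oU) setI_bigcupl measure_bigcup//;
    last 2 first.
  - by move=> k _; exact: mJI.
  - exact: trivIset_setIr.
  apply: lime_le; first by apply: is_cvg_nneseries => *; exact: measure_ge0.
  apply: nearW => n.
  rewrite (eq_bigl xpredT); last by move=> i; rewrite in_setT.
  apply: (@le_trans _ _ (\sum_(0 <= k < n) (F (p k).2 - F (p k).1)%:E)%E).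
    apply: lee_sum => k _; have [/and3P[p0 p12 p1] _ kp _] := pJ k.
    rewrite -lebesgue_stieltjes_itvoc// le_measure ?inE//.
    exact: mJI.
  rewrite sumEFin lee_fin /index_iota subn0.
  have := Fd _ (subL n); rewrite !big_map; apply.
  rewrite -lte_fin; apply: le_lt_trans Ud.
  apply: (@le_trans _ _ (\sum_(0 <= k < n) mu (J k))%E).
    rewrite /index_iota subn0 -sumEFin; apply: lee_sum => k _.
    have [/and3P[p0 p12 p1] _ _ kp] := pJ k.
    have -> : ((p k).2 - (p k).1)%:E = mu `](p k).1, (p k).2[%classic.
      rewrite lebesgue_measure_itv/= lte_fin lt_neqAle p12 andbT.
      by have [->|] := eqVneq; rewrite ?subrr.
    apply: le_measure; rewrite ?inE; [exact: measurable_itv|exact: mJ|].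
    by move=> x /kp[].
  rewrite [in leRHS](open_disjoint_itv_bigcup oU) measure_bigcup; last 2 first.
  - by move=> k _; exact: mJ.
  - exact: tJ.
  rewrite (eq_eseriesl (Q := xpredT)); last by move=> i; rewrite in_setT.
  by apply: nneseries_lim_ge => *; exact: measure_ge0.
have mAI : measurable (A `&` `]0, 1]) by exact: measurableI.
have mUI : measurable (U `&` `]0, 1]) by exact: measurableI.
apply: le_trans nuU; apply: le_measure; rewrite ?inE.
- exact: mAI.
- exact: mUI.
- exact: setSI.
Qed.

End density.

Section density_of_monotone.
Context {R : realType}.
Notation mu := (@lebesgue_measure R).

(** Composing with this retraction extends a function on [0, 1] to the line by constants and keeps
    monotonicity. *)
Definition clamp (x : R) : R := Num.max 0 (Num.min x 1).

Lemma clamp01 x : 0 <= clamp x <= 1.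
Proof. by rewrite le_max lexx/= ge_max ler01/= ge_min lexx orbT. Qed.

Lemma clamp_id x : 0 <= x <= 1 -> clamp x = x.
Proof.
by move=> /andP[x0 x1]; rewrite /clamp; rewrite (min_idPl _)// (max_idPr _).
Qed.

Lemma le_clamp x y : x <= y -> clamp x <= clamp y.
Proof.
move=> xy; rewrite /clamp /Num.max /Num.min.
by do !case: ifPn => //; rewrite -?leNgt => *; lra.
Qed.

Lemma clamp_contraction x y : x <= y -> clamp y - clamp x <= y - x.
Proof.
move=> xy; rewrite /clamp /Num.max /Num.min.
by do !case: ifPn => //; rewrite -?leNgt => *; lra.
Qed.

(** The density is the Radon-Nikodym derivative of the Lebesgue-Stieltjes measure of [F \o clamp],
    restricted to ]0, 1]. One-interval absolute continuity makes that function right-continuous. *)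
Lemma nondecreasing_density (F : R -> R) :
  {in `[0, 1] &, {homo F : x y / x <= y}} ->
  (forall e, 0 < e -> exists2 d, 0 < d & forall L, subpartition L ->
    \sum_(p <- L) (p.2 - p.1) < d -> \sum_(p <- L) (F p.2 - F p.1) <= e) ->
  exists phi : R -> R, mu.-integrable setT (EFin \o phi) /\
    forall x, 0 <= x <= 1 -> F x - F 0 = \int[mu]_(t in `[0, x]) phi t.
Proof.
move=> ndF acF; pose G := F \o clamp.
have ndG : {homo G : x y / x <= y}.
  by move=> x y xy; apply: ndF; rewrite ?in_itv/= ?clamp01//; exact: le_clamp.
have rcG x : G y @[y --> x^'+] --> G x.
  apply/cvgrPdist_lt => e e0; have [d d0 Fd] :=
    acF (e / 2) ltac:(by rewrite divr_gt0).
  near=> y.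
  have xy : x < y by near: y; exact: nbhs_right_gt.
  have yd : y - x < d by rewrite ltrBlDl; near: y; apply: nbhs_right_lt;
    rewrite ltrDl.
  rewrite ler0_norm ?subr_le0 ?ndG ?ltW// opprB.
  apply: (@le_lt_trans _ _ (e / 2));
    last by rewrite ltr_pdivrMr// ltr_pMr// ltr1n.
  have := Fd [:: (clamp x, clamp y)].
  rewrite /subpartition/= !big_seq1/=; apply.
    by rewrite (andP (clamp01 x)).1 (andP (clamp01 y)).2 le_clamp ?ltW.
  by rewrite (le_lt_trans _ yd)// clamp_contraction// ltW.
pose Gc : cumulative R R := HB.pack G (isCumulative.Build R _ R G ndG rcG).
have mI : measurable (`]0, 1]%classic : set R) by exact: measurable_itv.
have nuI : (lebesgue_stieltjes_measure Gc (`]0%R, 1%R]%classic :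
  set R) < +oo)%E.
  by rewrite lebesgue_stieltjes_itvoc ?ltry.
pose nu : {finite_measure set (measurableTypeR R) -> \bar R} :=
  @mfrestr _ (measurableTypeR R) R _ (lebesgue_stieltjes_measure Gc) mI nuI.
have nuE B : nu B = lebesgue_stieltjes_measure Gc (B `&` `]0, 1]) by [].
have numu : nu `<< mu.
  apply/null_content_dominatesP => A mA A0; rewrite nuE.
  apply: lebesgue_stieltjes_null => // e /acF[d d0 Fd];
    exists d => // L subL Ld.
  apply: le_trans (Fd L subL Ld); rewrite !big_seq; apply: ler_sum => p pL.
  move/andP : subL => [/allP + _] => /(_ p pL) /and3P[p0 p12 p1].
  by rewrite /= /G /= !clamp_id//; apply/andP; split=> //; lra.
have [phi [phi0 phifin intphi phiE]] := radon_nikodym_sigma_finite numu.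
exists (fine \o phi).
have phiK : EFin \o (fine \o phi) = phi by apply/funext => x /=; rewrite fineK.
split; first by rewrite phiK.
move=> x x01; have /andP[x0 x1] := x01.
rewrite -Rintegral_itv_obnd_cbnd; last first.
  by rewrite phiK; apply: integrableS intphi.
rewrite /Rintegral.
have -> : (\int[mu]_(t in `]0%R, x]) (EFin \o (fine \o phi)) t =
  (F x - F 0)%:E)%E.
  rewrite phiK -phiE; last exact: measurable_itv.
  rewrite nuE setIidl; last first.
    by move=> y; rewrite /= !in_itv/= => /andP[-> yx]; exact: le_trans yx x1.
  by rewrite lebesgue_stieltjes_itvoc// /Gc/= /G/= !clamp_id// lexx ler01.
by [].
Unshelve. all: by end_near. Qed.

End density_of_monotone.

Section density_of_absolutely_continuous.
Context {R : realType}.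
Notation mu := (@lebesgue_measure R).
Local Notation TV := (@total_variation R).

Lemma absolutely_continuous_density (f : R -> R) : absolutely_continuous f ->
  exists phi : R -> R, mu.-integrable setT (EFin \o phi) /\
    forall x, 0 <= x <= 1 -> f x - f 0 = \int[mu]_(t in `[0, x]) phi t.
Proof.
move=> acf; have bvf := absolutely_continuous_bounded_variation acf.
pose P x := fine (TV 0 x f).
have tvfin x : 0 <= x <= 1 -> TV 0 x f \is a fin_num.
  by move=> /andP[x0 x1]; apply/bounded_variationP => //;
    exact: bounded_variationl bvf.
have PE a b : 0 <= a -> a <= b -> b <= 1 -> (P b - P a)%:E = TV a b f.
  move=> a0 ab b1; rewrite /P EFinB !fineK ?tvfin//.
  - rewrite (total_variationD f a0 ab) addeAC subee ?add0e// tvfin// a0.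
    exact: le_trans b1.
  - by rewrite a0 (le_trans ab).
  - by rewrite b1 (le_trans a0).
have Pf a b : 0 <= a -> a <= b -> b <= 1 -> `|f b - f a| <= P b - P a.
  by move=> a0 ab b1; rewrite -lee_fin PE// total_variation_ge.
have acP e : 0 < e -> exists2 d, 0 < d & forall L, subpartition L ->
    \sum_(p <- L) (p.2 - p.1) < d -> \sum_(p <- L) (P p.2 - P p.1) <= e.
  move=> e0; have [d d0 fd] := absolutely_continuous_total_variation acf e0.
  exists d => // L subL Ld; have := fd L subL Ld.
  rewrite -lee_fin; apply: le_trans; rewrite -sumEFin le_eqVlt; apply/orP; left.
  apply/eqP/eq_big_seq => p pL; rewrite PE//;
  by move/andP : subL => [/allP + _] => /(_ p pL) /and3P[].
have [||phi1 [intphi1 phi1E]] := @nondecreasing_density R P.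
- move=> x y; rewrite !in_itv/= => /andP[x0 x1] /andP[y0 y1] xy.
  by rewrite -subr_ge0 (le_trans _ (Pf _ _ x0 xy y1)).
- exact: acP.
have [||phi2 [intphi2 phi2E]] := @nondecreasing_density R (P \- f).
- move=> x y; rewrite !in_itv/= => /andP[x0 x1] /andP[y0 y1] xy.
  have := Pf _ _ x0 xy y1; rewrite ler_norml => /andP[_]; lra.
(* An increment of [P \- f] is at most twice that of [P], hence the half. *)
- move=> e e0; have [d d0 Pd] := acP (e / 2) ltac:(by rewrite divr_gt0).
  exists d => // L subL Ld; have := Pd L subL Ld => H.
  rewrite [leRHS]splitr; apply: le_trans (lerD H H).
  rewrite -big_split/= !big_seq; apply: ler_sum => p pL.
  move/andP : subL => [/allP + _] => /(_ p pL) /and3P[p0 p12 p1].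
  have := Pf _ _ p0 p12 p1; rewrite ler_norml => /andP[+ _]; lra.
exists (phi1 \- phi2); split.
  have -> : EFin \o (phi1 \- phi2) =
    ((EFin \o phi1) \- (EFin \o phi2))%E by exact/funext.
  exact: integrableB.
move=> x x01; rewrite RintegralB//.
- by rewrite -phi1E// -phi2E//=; ring.
- by apply: integrableS intphi1.
- by apply: integrableS intphi2.
Qed.

Lemma absolutely_continuous_derive1 (f : R -> R) : absolutely_continuous f ->
  exists phi : R -> R, [/\ mu.-integrable setT (EFin \o phi),
    (forall x, 0 <= x <= 1 -> f x - f 0 = \int[mu]_(t in `[0, x]) phi t) &
    \forall x \ae mu, x \in `[0, 1] -> derive1 f x = phi x].
Proof.
move=> /absolutely_continuous_density[phi [intphi phiE]]; exists phi;
  split=> //.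
(* The endpoints are discarded because f and its integral representation are only known to agree on
   [0, 1], while the derivative needs agreement on a neighbourhood. *)
have : {ae mu, forall x, x <> 0}.
  exists [set 0]; split => //; first exact: lebesgue_measure_set1.
  by move=> x /=; apply: contrapT.
have : {ae mu, forall x, x <> 1}.
  exists [set 1]; split => //; first exact: lebesgue_measure_set1.
  by move=> x /=; apply: contrapT.
pose G x : R := \int[mu]_(t in `[0, x]) phi t.
have intphiN y : mu.-integrable `[0, y] (EFin \o phi) by apply: integrableS
  intphi.
have locphi : locally_integrable [set: R] phi.
  by apply: open_integrable_locally => //; exact: openT.
have := FTC1 intphiN locphi; rewrite -/G.
apply: filterS3; first exact: (ae_filter_ringOfSetsType mu).
move=> x dphi x1 x0 /[!in_itv]/= /andP[x0' x1'].
have {}x0 : 0 < x by rewrite lt_neqAle x0' andbT eq_sym; exact/eqP.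
have {}x1 : x < 1 by rewrite lt_neqAle x1' andbT; exact/eqP.
have lx : ((BLeft 0%R : itv_bound R) < BRight x)%E by rewrite /= lte_fin.
have [dG <-] := dphi lx.
have fG : \near x, f x = G x + f 0.
  have : \forall y \near x, y \in `]0, 1[ by apply: near_in_itvoo;
    rewrite in_itv/= x0.
  apply: filterS => y; rewrite in_itv/= => /andP[y0 y1].
  by rewrite /G -phiE ?subrK// (ltW y0) ltW.
rewrite !derive1E (near_eq_derive _ fG).
have -> : (fun x => G x + f 0) = G + cst (f 0) by apply/funext.
rewrite deriveD; [by rewrite derive_cst addr0|exact: dG|exact: derivable_cst].

Qed.

End density_of_absolutely_continuous.

Section nonmeasurable_ae_eq.
Context d (T : measurableType d) (R : realType).
Variable m : {measure set T -> \bar R}.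
Local Open Scope ereal_scope.
Import HBNNSimple.

(** A simple function below [u], multiplied by the indicator of the complement of [N], lies below
    [v] and keeps its integral. *)
Let le_integral_eq_off_null (u v : T -> \bar R) (N : set T) :
  measurable N -> m N = 0 -> (forall x, 0 <= u x) -> (forall x, 0 <= v x) ->
  (forall x, ~ N x -> u x = v x) -> \int[m]_x u x <= \int[m]_x v x.
Proof.
move=> mN N0 u0 v0 uv; rewrite !ge0_integralTE//.
apply: ge_ereal_sup => _ [h /= hu <-]; apply: ereal_sup_ubound => /=.
have mNC : measurable (~` N) by exact: measurableC.
exists (proj_nnsfun h mNC).
  move=> x; rewrite /= mindicE; have [/set_mem Nx|] := boolP (x \in ~` N).
    by rewrite mulr1 -uv.
  by rewrite mulr0.
rewrite -!integralT_nnsfun; apply: ge0_ae_eq_integral => //.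
- by apply/measurable_EFinP; exact: measurable_funP.
- by apply/measurable_EFinP; exact: measurable_funP.
- by move=> x _; rewrite lee_fin.
- by move=> x _; rewrite lee_fin.
exists N; split => // x /=; apply: contra_notP => Nx _.
by rewrite mindicE mem_set// mulr1.
Qed.

(* Without measurability: two integrands that differ only on a null set     *)
(* dominate the same simple functions up to a null set. Needed because      *)
(* derive1 f need not be Borel measurable a priori.                         *)
Lemma ge0_ae_eq_integral_nonmeasurable (D : set T) (u v : T -> \bar R) :
  (forall x, 0 <= u x) -> (forall x, 0 <= v x) -> ae_eq m D u v ->
  \int[m]_(x in D) u x = \int[m]_(x in D) v x.
Proof.
move=> u0 v0 [N [mN N0 subN]].
have uv x : ~ N x -> (u \_ D) x = (v \_ D) x.
  move=> Nx; rewrite !patchE; case: ifPn => // /set_mem Dx.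
  by apply: contrapT => uvx; apply: Nx; apply: subN => /= /(_ Dx).
have p0 (w : T -> \bar R) : (forall x, 0 <= w x) -> forall x, 0 <= (w \_ D) x.
  by move=> w0 x; rewrite patchE; case: ifP.
rewrite integral_mkcond [RHS]integral_mkcond.
apply/eqP; rewrite eq_le; apply/andP; split;
  apply: (le_integral_eq_off_null mN N0); try exact: p0; first exact: uv.
by move=> x Nx; rewrite uv.
Qed.

End nonmeasurable_ae_eq.

(** * Representatives of the derivative *)

Section derivative_representative.
Context {R : realType}.
Notation mu := (@lebesgue_measure R).
Local Notation TV := (@total_variation R).

(** Measurability comes from the Jordan decomposition into monotone functions, made monotone on the
    whole line by [clamp]; boundedness comes from the variation. *)
Lemma bounded_variation_integrable (g : R -> R) : bounded_variation 0 1 g ->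
  mu.-integrable `[0, 1] (EFin \o g).
Proof.
move=> bvg.
have fI : (mu `[0%R, 1%R] < +oo)%E by rewrite lebesgue_measure_itv/= lte_fin
  ltr01 ltry.
apply: measurable_bounded_integrable => //.
- have nd (h : R -> R) : bounded_variation 0 1 h ->
      measurable_fun (`[0, 1]%classic :
        set R) ((fine \o neg_tv 0 h) \o @clamp R).
    move=> bvh; apply: nondecreasing_measurable => // x y xy /=.
    by apply: (fine_neg_tv_nondecreasing bvh);
      rewrite ?in_itv/= ?clamp01// le_clamp.
  apply: (eq_measurable_fun (((fine \o pos_tv 0 g) \o @clamp R) \-
                             ((fine \o neg_tv 0 g) \o @clamp R))).
    move=> x; rewrite inE /= => xI; have x01 : 0 <= x <= 1 by move: xI;
      rewrite in_itv.
    by rewrite clamp_id// [RHS](bounded_variation_pos_neg_tvE bvg).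
  apply: measurable_funB; last exact: nd.
  by apply: nd; exact: bounded_variationN.
- have tvfin : TV 0 1 g \is a fin_num by apply/bounded_variationP.
  exists (`|g 0| + fine (TV 0 1 g)); split; first exact: num_real.
  move=> M ltM x /=; rewrite in_itv/= => /andP[x0 x1].
  apply: le_trans (ltW ltM); rewrite -[X in `|X|](subrK (g 0)) addrC.
  rewrite (le_trans (ler_normD _ _))// lerD2l -lee_fin fineK//.
  apply: le_trans (total_variation_ge g x0) _.
  by rewrite (total_variationD g x0 x1) leeDl// total_variation_ge0.
Qed.

Lemma derivative_representative_integral (f g : R -> R) :
  absolutely_continuous f -> bounded_variation 0 1 g ->
  (\forall x \ae mu, x \in `[0, 1] -> g x = derive1 f x) ->
  forall a b, 0 <= a -> a <= b -> b <= 1 ->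
    f b - f a = \int[mu]_(t in `[a, b]) g t.
Proof.
move=> acf bvg gf'; have [phi [intphi phiE f'phi]] :=
  absolutely_continuous_derive1 acf.
have intg := bounded_variation_integrable bvg.
have gphi : \forall x \ae mu, x \in `[0, 1] -> g x = phi x.
  move: gf' f'phi; apply: filterS2; first exact: (ae_filter_ringOfSetsType mu).
  by move=> x gx phix xI; rewrite gx// phix.
have int0 x : 0 <= x <= 1 -> f x - f 0 = \int[mu]_(t in `[0, x]) g t.
  move=> /andP[x0 x1]; rewrite phiE ?x0// /Rintegral; congr fine.
  apply: ae_eq_integral => //.
  - by apply: measurable_funS (measurable_int _ intphi).
  - apply: measurable_funS (measurable_int _ intg) => //.
    by apply: subset_itvl; rewrite bnd_simp.
  - move: gphi; apply: filterS; first exact: (ae_filter_ringOfSetsType mu).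
    move=> y gy /=; rewrite in_itv/= => /andP[y0 yx]; rewrite gy// in_itv/= y0.
    exact: le_trans yx x1.
move=> a b a0 ab b1.
have b0 : 0 <= b by exact: le_trans ab.
have intgb : mu.-integrable `[0, b] (EFin \o g).
  by apply: integrableS intg => //; apply: subset_itvl; rewrite bnd_simp.
have -> : f b - f a = (f b - f 0) - (f a - f 0) by ring.
rewrite !int0 ?a0 ?b0 ?b1 ?(le_trans ab)//.
rewrite (@Rintegral_itvB _ g (BLeft 0) (BRight b) a)// ?bnd_simp//.
rewrite Rintegral_itv_obnd_cbnd//.
by apply: integrableS intgb => //; apply: subset_itvr; rewrite bnd_simp.
Qed.

(** It makes the value of the integral independent of [g], so that A stays fixed while the variation
    is minimised over representatives. *)
Lemma derivative_representative_deriv_dev (f g : R -> R) :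
  bounded_variation 0 1 g ->
  (\forall x \ae mu, x \in `[0, 1] -> g x = derive1 f x) ->
  deriv_dev f = (\int[mu]_(t in `[0, 1]) `|g t - (f 1 - f 0)|)%:E.
Proof.
move=> bvg gf'; rewrite /deriv_dev /norm1.
have fI : (mu `[0%R, 1%R] < +oo)%E.
  by rewrite lebesgue_measure_itv/= lte_fin ltr01 ltry.
rewrite -(@ge0_ae_eq_integral_nonmeasurable _ _ _ mu _
  (fun t => (`|g t - (f 1 - f 0)|%R)%:E)) => //.
  rewrite /Rintegral fineK//; apply: integrable_fin_num => //.
  have -> : (fun t => (`|g t - (f 1 - f 0)|%R)%:E) =
    abse \o ((EFin \o g) \- (EFin \o cst (f 1 - f 0)%R))%E by exact/funext.
  apply: integrable_abse; apply: integrableB => //.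
    exact: bounded_variation_integrable.
  apply: measurable_bounded_integrable => //.
  exact: bounded_cst.
move: gf'; apply: filterS; first exact: (ae_filter_ringOfSetsType mu).
by move=> x gx xI; rewrite gx.
Qed.

End derivative_representative.

(** * Estimates on one cell *)

Section segment_integrals.
Context {R : realType}.
Notation mu := (@lebesgue_measure R).
Local Notation TV := (@total_variation R).
Local Notation Int a b h := (\int[mu]_(t in `[a, b]) h t).
Implicit Types (a b c : R) (g h : R -> R).

Definition segment_integrable a b h := mu.-integrable `[a, b] (EFin \o h).

Lemma segment_fin_measure a b : (mu (`[a, b]%classic : set R) < +oo)%E.
Proof.
by rewrite lebesgue_measure_itv/= lte_fin; case: ifP => // _;
  rewrite -EFinB ltry.
Qed.

Lemma segment_integrable_cst a b c : segment_integrable a b (fun=> c).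
Proof.
have fI := segment_fin_measure a b.
apply: measurable_bounded_integrable => //; exact: bounded_cst.
Qed.

Lemma segment_integrableD a b g h : segment_integrable a b g ->
  segment_integrable a b h -> segment_integrable a b (fun t => g t + h t).
Proof.
move=> ig ih; have := integrableD _ ig ih; apply; exact: measurable_itv.
Qed.

Lemma segment_integrableB a b g h : segment_integrable a b g ->
  segment_integrable a b h -> segment_integrable a b (fun t => g t - h t).
Proof.
move=> ig ih; have := integrableB _ ig ih; apply; exact: measurable_itv.
Qed.

Lemma segment_integrableZ a b c g : segment_integrable a b g ->
  segment_integrable a b (fun t => c * g t).
Proof.
move=> ig; have := integrableZl _ c ig; apply; exact: measurable_itv.
Qed.

Lemma segment_integrable_norm a b g : segment_integrable a b g ->
  segment_integrable a b (fun t => `|g t|).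
Proof. by move=> ig; have := integrable_norm ig. Qed.

Lemma segment_integrableS a b c d g : a <= c -> d <= b ->
  segment_integrable a b g -> segment_integrable c d g.
Proof.
move=> ac db ig; apply: integrableS ig => //.
by apply: subset_itv; rewrite bnd_simp.
Qed.

Lemma segment_Rintegral_cst a b c : a <= b -> Int a b (fun=> c) = c * (b - a).
Proof.
move=> ab; have muab : mu (`[a, b]%classic : set R) = (b - a)%:E.
  rewrite lebesgue_measure_itv/= lte_fin.
  by move: ab; rewrite le_eqVlt => /predU1P[->|->//]; rewrite ltxx subrr.
rewrite Rintegral_cst//; congr (_ * _); exact: (congr1 fine muab).
Qed.

Lemma segment_Rintegral_split a b c g : a <= b -> b <= c ->
  segment_integrable a c g -> Int a c g = Int a b g + Int b c g.
Proof.
move=> ab bc ig; rewrite -(@Rintegral_itv_obnd_cbnd _ b).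
  by rewrite -(@Rintegral_itvB _ g (BLeft a) (BRight c) b) ?bnd_simp//
    addrC subrK.
by apply: integrableS ig => //; apply: subset_itvr; rewrite bnd_simp.
Qed.

Lemma le_segment_Rintegral a b g h : segment_integrable a b g ->
  segment_integrable a b h -> (forall t, a <= t <= b -> g t <= h t) ->
  Int a b g <= Int a b h.
Proof.
move=> ig ih gh; apply: le_Rintegral => // t /=; rewrite in_itv/=; exact: gh.
Qed.

Lemma segment_integrable_continuous a b g : {within `[a, b], continuous g} ->
  segment_integrable a b g.
Proof. by move=> cg; apply: continuous_compact_integrable => //;
  exact: segment_compact. Qed.

Lemma segment_integrable_affine a b p q : segment_integrable a b (fun t =>
  p + q * t).
Proof.
apply: segment_integrable_continuous; apply: continuous_subspaceT => x.
by apply: cvgD; [exact: cvg_cst|apply: cvgM; [exact: cvg_cst|exact: cvg_id]].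
Qed.

Lemma segment_Rintegral_affine a b p q : a <= b ->
  Int a b (fun t => p + q * t) = p * (b - a) + q * (b ^+ 2 - a ^+ 2) / 2.
Proof.
rewrite le_eqVlt => /predU1P[<-|ab].
  by rewrite set_itv1 Rintegral_set1 !subrr !mulr0 mul0r addr0.
pose F x : R := p * x + q / 2 * (x * x).
have dF (x : R) : is_derive x (1 : R) F (p + q * x).
  by rewrite /F; apply: is_derive_eq; rewrite /GRing.scale/=; field.
suff H : (\int[mu]_(x in `[a, b]) (p + q * x)%:E = (F b)%:E - (F a)%:E)%E.
  by rewrite /Rintegral H /F/=; field.
apply: continuous_FTC2 => //.
- apply: continuous_subspaceT => x.
  by apply: cvgD; [exact: cvg_cst|apply: cvgM; [exact: cvg_cst|exact: cvg_id]].
- have cF : continuous F.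
    by move=> x; apply: differentiable_continuous; apply/derivable1_diffP;
      case: (dF x).
  split; first by move=> x _; case: (dF x).
    exact/cvg_at_right_filter/cF.
  exact/cvg_at_left_filter/cF.
- by move=> x _; rewrite derive1E; apply: derive_val.
Qed.

Lemma total_variation_range a b g : a <= b -> TV a b g \is a fin_num ->
  exists l, forall x, a <= x <= b -> l <= g x <= l + fine (TV a b g).
Proof.
move=> ab fin.
have key x y : a <= x -> x <= y -> y <= b -> `|g y - g x| <= fine (TV a b g).
  move=> ax xy yb; rewrite -lee_fin fineK//.
  rewrite (total_variationD g (le_trans ax xy) yb) (total_variationD g ax xy).
  apply: (le_trans (total_variation_ge g xy)).
  by rewrite -addeA addeCA leeDl// adde_ge0// total_variation_ge0.
have key2 x y : a <= x <= b -> a <= y <= b -> g x - fine (TV a b g) <= g y.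
  move=> /andP[ax xb] /andP[ay yb]; have [xy|/ltW yx] := leP x y.
    by have := key _ _ ax xy yb; rewrite ler_norml => /andP[]; lra.
  by have := key _ _ ay yx xb; rewrite ler_norml => /andP[]; lra.
pose S := [set g x | x in [set x | a <= x <= b]].
have S0 : S !=set0 by exists (g a), a => //=; rewrite lexx ab.
have lS : has_lbound S.
  exists (g a - fine (TV a b g)) => _ [y /= yab <-]; apply: key2 => //.
  by rewrite lexx.
exists (inf S) => x xab; apply/andP; split.
  by apply: ge_inf => //; exists x.
by rewrite -lerBlDr; apply: lb_le_inf => // _ [y /= yab <-]; exact: key2.
Qed.

(** The chord of |x - A| over [l, l + T] takes at the mean A the value 2 (l + T - A) (A - l) / T,
    which is at most T / 2 because the two factors sum to T. *)
Lemma Rintegral_dist_mean a b g l T : a < b -> segment_integrable a b g ->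
  (forall x, a <= x <= b -> l <= g x <= l + T) ->
  Int a b (fun t => `|g t - Int a b g / (b - a)|) <= T * (b - a) / 2.
Proof.
move=> ab ig gl; have ba0 : 0 < b - a by rewrite subr_gt0.
have leab := ltW ab.
have ilo : segment_integrable a b (fun=> l) by exact: segment_integrable_cst.
have ihi : segment_integrable a b (fun=> l + T) by exact:
  segment_integrable_cst.
set A := Int a b g / (b - a).
have AE : Int a b g = A * (b - a) by rewrite /A divfK// gt_eqF.
have Al : l <= A <= l + T.
  rewrite /A ler_pdivlMr// ler_pdivrMr//; apply/andP; split.
    rewrite -segment_Rintegral_cst//; apply: le_segment_Rintegral => // x /gl.
    by case/andP.
  rewrite -segment_Rintegral_cst//; apply: le_segment_Rintegral => // x /gl.
  by case/andP.
have T0 : 0 <= T by have := gl a; rewrite lexx ltW// => /(_ isT); lra.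
have iabs : segment_integrable a b (fun t => `|g t - A|).
  by apply/segment_integrable_norm/segment_integrableB => //;
    exact: segment_integrable_cst.
(* The slope of the chord divides by [T]; for [T = 0] the function is constant on the segment. *)
have [T0'|Tn0] := eqVneq T 0.
  apply: (@le_trans _ _ (Int a b (fun=> 0))); last first.
    by rewrite segment_Rintegral_cst// T0' !mul0r.
  apply: le_segment_Rintegral => //; first exact: segment_integrable_cst.
  by move=> t /gl; move: Al; rewrite T0' ler_norml; lra.
have {T0 Tn0}T0 : 0 < T by rewrite lt_neqAle eq_sym Tn0.
(* convexity: [|x - A|] lies below its chord over [l, l + T] *)
pose q := ((A - l) - (l + T - A)) * - T^-1.
pose p := (A - l) - q * l.
apply: (@le_trans _ _ (Int a b (fun t => p + q * g t))).
  apply: le_segment_Rintegral => //.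
    apply: segment_integrableD; first exact: segment_integrable_cst.
    exact: segment_integrableZ.
  move=> t /gl /andP[gtl gtT].
  have pq : T * (p + q * g t) = (l + T - g t) * (A - l) + (g t - l) * (l + T -
    A).
    by rewrite /p /q; field; rewrite gt_eqF.
  rewrite -(ler_pM2l T0) pq; case/andP : Al => Al AT.
  have [gA|gA] := leP A (g t).
    by rewrite ger0_norm ?subr_ge0//; nra.
  by rewrite ltr0_norm ?subr_lt0//; nra.
have -> : Int a b (fun t => p + q * g t) = (p + q * A) * (b - a).
  rewrite RintegralD//; last 2 first.
  - exact: segment_integrable_cst.
  - exact: segment_integrableZ.
  rewrite segment_Rintegral_cst// RintegralZl// AE; ring.
have pq : T * (p + q * A) = 2 * ((l + T - A) * (A - l)).
  by rewrite /p /q; field; rewrite gt_eqF.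
rewrite [leRHS]mulrAC ler_pM2r// -(ler_pM2l T0) pq.
by have := sqr_ge0 ((l + T - A) - (A - l)); rewrite expr2; nra.
Qed.

Lemma le_norm_Rintegral_dist a b g c : a <= b -> segment_integrable a b g ->
  `|Int a b g - c * (b - a)| <= Int a b (fun t => `|g t - c|).
Proof.
move=> ab ig; have ic := segment_integrable_cst a b c.
rewrite -segment_Rintegral_cst// -RintegralB//; apply: le_normr_Rintegral => //.
exact: segment_integrableB.
Qed.

Lemma Rintegral_dist_le a b g l T c : a < b -> segment_integrable a b g ->
  (forall x, a <= x <= b -> l <= g x <= l + T) ->
  Int a b (fun t => `|g t - c|) <= `|Int a b g - c * (b - a)| + T * (b - a) / 2.
Proof.
move=> ab ig gl; have ba0 : 0 < b - a by rewrite subr_gt0.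
have leab := ltW ab.
set A := Int a b g / (b - a).
have AE : Int a b g = A * (b - a) by rewrite /A divfK// gt_eqF.
have iA : segment_integrable a b (fun t => `|g t - A|).
  by apply/segment_integrable_norm/segment_integrableB => //;
    exact: segment_integrable_cst.
have icst := segment_integrable_cst a b `|A - c|.
apply: (@le_trans _ _ (Int a b (fun t => `|A - c| + `|g t - A|))).
  apply: le_segment_Rintegral.
  - by apply/segment_integrable_norm/segment_integrableB => //;
    exact: segment_integrable_cst.
  - exact: segment_integrableD.
  - move=> t _; have -> : g t - c = (A - c) + (g t - A) by ring.
    exact: ler_normD.
rewrite RintegralD// segment_Rintegral_cst// AE -mulrBl normrM (gtr0_norm ba0).
by rewrite lerD2l; exact: (Rintegral_dist_mean ab ig gl).
Qed.

(** All slopes of f lie in [l, l + T], so f is caught between lines of these slopes through (a, f a)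
    on the left half and through (b, f b) on the right half. The integrals of both envelopes miss
    the trapezoid by exactly T (b - a)^2 / 8. *)
Lemma trapezoid_cell_error a b f g l T : a <= b -> segment_integrable a b g ->
  {within `[a, b], continuous f} ->
  (forall x y, a <= x -> x <= y -> y <= b -> f y - f x = Int x y g) ->
  (forall x, a <= x <= b -> l <= g x <= l + T) ->
  `|Int a b f - (b - a) * (f a + f b) / 2| <= T * (b - a) ^+ 2 / 8.
Proof.
move=> ab ig cf fE gl; have if' := segment_integrable_continuous cf.
have slope x y : a <= x -> x <= y -> y <= b ->
    l * (y - x) <= f y - f x <= (l + T) * (y - x).
  move=> ax xy yb; rewrite fE//.
  have ixy : segment_integrable x y g by exact: segment_integrableS ig.
  rewrite -!segment_Rintegral_cst//; apply/andP; split;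
    apply: le_segment_Rintegral => //; try exact: segment_integrable_cst;
    move=> t /andP[xt ty]; have /gl/andP[] // : a <= t <= b by lra.
pose m := (a + b) / 2.
have am : a <= m by rewrite /m; lra.
have mb : m <= b by rewrite /m; lra.
rewrite (segment_Rintegral_split am mb if').
have ifa : segment_integrable a m f by exact: segment_integrableS if'.
have ifb : segment_integrable m b f by exact: segment_integrableS if'.
have iaff := segment_integrable_affine.
have ub1 : Int a m f <= (f a - (l + T) * a) * (m - a) + (l + T) * (m ^+ 2 - a
  ^+ 2) / 2.
  rewrite -segment_Rintegral_affine//;
    apply: le_segment_Rintegral => // t /andP[at' tm].
  by have /andP[_] := slope a t (lexx _) at' (le_trans tm mb); lra.
have lb1 : (f a - l * a) * (m - a) + l * (m ^+ 2 - a ^+ 2) / 2 <= Int a m f.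
  rewrite -segment_Rintegral_affine//;
    apply: le_segment_Rintegral => // t /andP[at' tm].
  by have /andP[+ _] := slope a t (lexx _) at' (le_trans tm mb); lra.
have ub2 : Int m b f <= (f b - l * b) * (b - m) + l * (b ^+ 2 - m ^+ 2) / 2.
  rewrite -segment_Rintegral_affine//;
    apply: le_segment_Rintegral => // t /andP[mt tb].
  by have /andP[+ _] := slope t b (le_trans am mt) tb (lexx _); lra.
have lb2 : (f b - (l + T) * b) * (b - m) + (l + T) * (b ^+ 2 - m ^+ 2) / 2 <=
  Int m b f.
  rewrite -segment_Rintegral_affine//;
    apply: le_segment_Rintegral => // t /andP[mt tb].
  by have /andP[_] := slope t b (le_trans am mt) tb (lexx _); lra.
rewrite ler_norml; apply/andP; split.
  rewrite lerBrDl; apply: le_trans (lerD lb1 lb2); rewrite le_eqVlt;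
    apply/orP; left.
  by apply/eqP; rewrite /m; field.
rewrite lerBlDl; apply: le_trans (lerD ub1 ub2) _; rewrite le_eqVlt;
  apply/orP; left.
by apply/eqP; rewrite /m; field.
Qed.

End segment_integrals.

Section shift.
Context {R : realType}.
Notation mu := (@lebesgue_measure R).
Local Notation TV := (@total_variation R).
Local Notation Int a b h := (\int[mu]_(t in `[a, b]) h t).
Implicit Types (a b c : R) (g : R -> R).

Definition translation (s : R) : measurableTypeR R -> measurableTypeR R :=
  fun x => (x : R) + s.

Lemma measurable_translation (s : R) : measurable_fun setT (translation s).
Proof.
have : measurable_fun setT (fun x : R => x + s) by exact: measurable_funD.
by [].
Qed.

Lemma lebesgue_measure_shift (s : R) (A : set R) : measurable A ->
  pushforward mu (translation s) A = mu A.
Proof.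
move=> mA; pose phi := translation s.
have mphi : measurable_fun setT phi by exact: measurable_translation.
apply/esym/(@lebesgue_measure_unique _ (pushforward mu phi)) =>
  //= _ [[a b]] _ <-.
rewrite /pushforward.
have -> : phi @^-1` `]a, b] = `]a - s, b - s]%classic.
  by apply/seteqP; split=> x; rewrite /= !in_itv/= /phi /translation ltrBlDr
    lerBrDr.
by rewrite !lebesgue_measure_itv/= !lte_fin ltrD2r -!EFinB opprD opprK addrACA
  addNr addr0.
Qed.

Lemma segment_integral_shift (s a b : R) (g : R -> R) :
  segment_integrable (a + s) (b + s) g ->
  segment_integrable a b (fun t => g (t + s)) /\
  Int (a + s) (b + s) g = Int a b (fun t => g (t + s)).
Proof.
move=> ig; pose phi := translation (- s).
have mphi : measurable_fun setT phi by exact: measurable_translation.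
(* [g] is measurable only on the segment; its extension by zero is measurable on the whole line, as
   the change of variables requires. *)
pose g' := g \_ `[a + s, b + s].
have mI : measurable (`[a + s, b + s]%classic : set R) by exact: measurable_itv.
have mg' : measurable_fun setT g'.
  by apply/(measurable_restrictT g mI)/measurable_EFinP;
    exact: measurable_int ig.
pose f : measurableTypeR R -> \bar R := EFin \o (g' \o translation s).
have mf : measurable_fun setT f.
  by apply/measurable_EFinP; apply: measurableT_comp => //;
    exact: measurable_translation.
have pre : phi @^-1` `[a, b] = `[a + s, b + s]%classic.
  by apply/seteqP; split=> x; rewrite /= !in_itv/= /phi /translation lerBrDr
    lerBlDr.
have fphi : {in `[a + s, b + s]%classic, f \o phi =1 EFin \o g}.
  by move=> x xI; rewrite /f /phi /translation /= subrK /g' patchE xI.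
have intf : mu.-integrable (phi @^-1` `[a, b]) (f \o phi).
  by rewrite pre; apply: eq_integrable ig => // x xI; rewrite fphi.
have fg : {in `[a, b]%classic, f =1 EFin \o (fun t => g (t + s))}.
  move=> x; rewrite inE/= in_itv/= => /andP[ax xb].
  by rewrite /f/= /g' patchE mem_set//= in_itv/= !lerD2r ax.
have pmu : forall A : set (measurableTypeR R), measurable A -> A `<=` `[a, b] ->
    pushforward mu phi A = mu A by move=> A mA _; exact: lebesgue_measure_shift.
have E1 : (\int[mu]_(x in `[a, b]) f x =
  \int[mu]_(x in `[(a + s)%R, (b + s)%R]) (g x)%:E)%E.
  rewrite (eq_measure_integral (pushforward mu phi)); last first.
    by move=> A mA AI; exact/esym/pmu.
  by rewrite integral_pushforward// pre; apply: eq_integral => x xI;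
    exact: fphi.
have iff : mu.-integrable `[a, b] f.
  have /integrableP[mf' fin] := @integrable_pushforward _ _ _ _ _ phi mphi mu
    `[a, b] f mf intf (measurable_itv _).
  apply/integrableP; split => //.
  rewrite (eq_measure_integral (pushforward mu phi))//.
  by move=> A mA AI; exact/esym/pmu.
split; first by apply: eq_integrable iff.
rewrite /Rintegral; congr fine.
by rewrite -E1; apply: eq_integral => x xI; exact: fg.
Qed.

End shift.

(** * Estimates on a uniform grid *)

Section uniform_grid.
Context {R : realType}.
Notation mu := (@lebesgue_measure R).
Local Notation TV := (@total_variation R).
Local Notation Int a b h := (\int[mu]_(t in `[a, b]) h t).
Implicit Types (f g : R -> R) (m j k : nat).

(** Indexed by the number of cells and from zero: [grid m j] is [node m.+1 j.+1]. *)
Definition grid m j : R := j%:R / m%:R.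

Lemma grid0 m : grid m 0 = 0.
Proof. by rewrite /grid mul0r. Qed.

Lemma grid_last m : (0 < m)%N -> grid m m = 1.
Proof. by move=> m0; rewrite /grid divff// pnatr_eq0 -lt0n. Qed.

Lemma gridS m j : grid m j.+1 = grid m j + m%:R^-1.
Proof. by rewrite /grid -natr1 mulrDl mul1r. Qed.

Lemma le_gridS m j : grid m j <= grid m j.+1.
Proof. by rewrite gridS lerDl invr_ge0. Qed.

Lemma grid_ge0 m j : 0 <= grid m j.
Proof. by rewrite divr_ge0. Qed.

Lemma grid_le1 m j : (j <= m)%N -> grid m j <= 1.
Proof.
case: m => [|m] jm; first by rewrite /grid invr0 mulr0 ler01.
by rewrite /grid ler_pdivrMr ?ltr0n// mul1r ler_nat.
Qed.

Lemma trapezoid_grid m f : (0 < m)%N -> trapezoid m.+1 f =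
  \sum_(0 <= j < m) (m%:R^-1 * (f (grid m j) + f (grid m j.+1)) / 2).
Proof.
case: m => // k _; rewrite /trapezoid.
have -> : (2 * k.+2%:R - 2 : R) = 2 * k.+1%:R by rewrite -[k.+2%:R]natr1; ring.
rewrite -mulr_suml -mulr_sumr big_split/= big_add1/=.
rewrite [X in _ = _ * (X + _) / _]big_nat_recl// [X in _ =
  _ * (_ + X) / _]big_nat_recr//=.
rewrite big_add1/= -![node _ _]/(grid _ _) /node/=.
have k0 : (k.+1%:R : R) != 0 by rewrite pnatr_eq0.
rewrite -/(grid k.+1 0) -/(grid k.+1 k.+1); set S := \sum_(0 <= i < k) _.
by field.
Qed.

Lemma Ftilde_grid m f : Ftilde m.+1 f =
  \sum_(0 <= j < m) `|f (grid m j.+1) - f (grid m j) - (f 1 - f 0) / m%:R|.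
Proof. by rewrite /Ftilde big_add1. Qed.

Lemma Fsecond_grid m f : Fsecond m.+1 f = m%:R *
  \sum_(0 <= j < m.-1) `|f (grid m j) - 2 * f (grid m j.+1) + f (grid m j.+2)|.
Proof. by rewrite /Fsecond big_add1. Qed.

Lemma total_variation_fin g a b : bounded_variation 0 1 g ->
  0 <= a -> a <= b -> b <= 1 -> TV a b g \is a fin_num.
Proof.
move=> bvg a0 ab b1; apply/bounded_variationP => //.
exact: (bounded_variationl ab b1 (bounded_variationr a0 (le_trans ab b1) bvg)).
Qed.

Lemma sum_total_variation g (y : nat -> R) k : bounded_variation 0 1 g ->
  (forall j, y j <= y j.+1) -> 0 <= y 0%N -> y k <= 1 ->
  \sum_(0 <= j < k) fine (TV (y j) (y j.+1) g) = fine (TV (y 0%N) (y k) g).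
Proof.
move=> bvg yS y0 yk.
have ynd i j : (i <= j)%N -> y i <= y j.
  by move/nondecreasing_seqP : yS; exact.
have fin a b := @total_variation_fin g a b bvg.
elim: k yk => [|k IH] yk; first by rewrite big_nil total_variationxx.
have yk' : y k <= 1 by exact: le_trans (yS k) yk.
rewrite big_nat_recr//= IH// (total_variationD g (ynd _ _ (leq0n k)) (yS k)).
rewrite fineD// fin// ?ynd//.
by apply: le_trans y0 _; exact: ynd.
Qed.

Lemma Rintegral_grid m F : (0 < m)%N -> segment_integrable 0 1 F ->
  Int 0 1 F = \sum_(0 <= j < m) Int (grid m j) (grid m j.+1) F.
Proof.
move=> m0 iF; suff H k : (k <= m)%N ->
    Int 0 (grid m k) F = \sum_(0 <= j < k) Int (grid m j) (grid m j.+1) F.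
  by rewrite -H// grid_last.
elim: k => [|k IH] km.
  by rewrite big_nil grid0 set_itv1 Rintegral_set1.
rewrite big_nat_recr//= -IH ?(ltnW km)//; apply: segment_Rintegral_split => //.
- exact: grid_ge0.
- exact: le_gridS.
- by apply: segment_integrableS iF => //; exact: grid_le1.
Qed.

Section representative.
Variables f g : R -> R.
Hypothesis cf : {within `[0, 1], continuous f}.
Hypothesis bvg : bounded_variation 0 1 g.
Hypothesis fE : forall a b, 0 <= a -> a <= b -> b <= 1 -> f b - f a = Int a b g.

Let v a b := fine (TV a b g).
Let ig : segment_integrable 0 1 g := bounded_variation_integrable bvg.

Let sum_v m : (0 < m)%N -> \sum_(0 <= j < m) v (grid m j) (grid m j.+1) = v 0 1.
Proof.
move=> m0; rewrite (sum_total_variation bvg (le_gridS m)) ?grid0 ?grid_last//.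
Qed.

Let rangev a b : 0 <= a -> a <= b -> b <= 1 ->
  exists l, forall x, a <= x <= b -> l <= g x <= l + v a b.
Proof.
by move=> a0 ab b1; apply: total_variation_range => //;
  exact: total_variation_fin.
Qed.

Lemma trapezoid_error m : (0 < m)%N ->
  `|integral01 f - trapezoid m.+1 f| <= v 0 1 / (8 * m%:R ^+ 2).
Proof.
move=> m0; have mn0 : (m%:R : R) != 0 by rewrite pnatr_eq0 -lt0n.
rewrite trapezoid_grid// /integral01.
rewrite (Rintegral_grid m0 (segment_integrable_continuous cf)) -sumrB.
apply: (le_trans (ler_norm_sum _ _ _)).
rewrite -(sum_v m0) mulr_suml; rewrite !big_nat;
  apply: ler_sum => j /andP[_ jm].
have x0 := grid_ge0 m j; have x1 := grid_le1 jm; have xx := le_gridS m j.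
have [l gl] := rangev x0 xx x1.
have := @trapezoid_cell_error _ (grid m j) (grid m j.+1) f g l _ xx _ _ _ gl.
have -> : grid m j.+1 - grid m j = m%:R^-1 by rewrite gridS addrC addKr.
have -> : v (grid m j) (grid m j.+1) / (8 * m%:R ^+ 2) =
    v (grid m j) (grid m j.+1) * m%:R^-1 ^+ 2 / 8 by field.
apply.
- exact: segment_integrableS ig.
- by apply: continuous_subspaceW cf; apply: subset_itv; rewrite bnd_simp.
- by move=> x y ax xy yb; apply: fE => //;
  [exact: le_trans ax|exact: le_trans x1].
Qed.

Let c := f 1 - f 0.
Let A := Int 0 1 (fun t => `|g t - c|).

Let idist : segment_integrable 0 1 (fun t => `|g t - c|).
Proof.
by apply/segment_integrable_norm/segment_integrableB => //;
  exact: segment_integrable_cst.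
Qed.

Lemma Ftilde_le m : (0 < m)%N -> Ftilde m.+1 f <= A.
Proof.
move=> m0; rewrite Ftilde_grid /A (Rintegral_grid m0 idist) !big_nat.
apply: ler_sum => j /andP[_ jm].
have x0 := grid_ge0 m j; have x1 := grid_le1 jm; have xx := le_gridS m j.
rewrite fE//; have -> : m%:R^-1 =
  grid m j.+1 - grid m j by rewrite gridS addrC addKr.
by apply: le_norm_Rintegral_dist => //; exact: segment_integrableS ig.
Qed.

Lemma le_Ftilde m : (0 < m)%N -> A <= Ftilde m.+1 f + v 0 1 / (2 * m%:R).
Proof.
move=> m0; rewrite Ftilde_grid /A (Rintegral_grid m0 idist).
rewrite -(sum_v m0) mulr_suml -big_split/= !big_nat.
apply: ler_sum => j /andP[_ jm].
have x0 := grid_ge0 m j; have x1 := grid_le1 jm.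
have xx : grid m j < grid m j.+1 by rewrite gridS ltrDl invr_gt0 ltr0n.
have [l gl] := rangev x0 (ltW xx) x1.
have igj : segment_integrable (grid m j) (grid m j.+1) g by exact:
  segment_integrableS ig.
have := Rintegral_dist_le c xx igj gl.
have -> : grid m j.+1 - grid m j = m%:R^-1 by rewrite gridS addrC addKr.
by rewrite -fE// ?(ltW xx)// invfM [2^-1 * _]mulrC mulrA.
Qed.

(* A second difference of f is the integral over one cell of a difference of  *)
(* translates of g; for a fixed offset the translated nodes partition a       *)
(* subinterval of [0, 1].                                                     *)
Lemma Fsecond_le m : (0 < m)%N -> Fsecond m.+1 f <= v 0 1.
Proof.
move=> m0; rewrite Fsecond_grid; have mp : 0 < (m%:R : R) by rewrite ltr0n.
rewrite mulrC -ler_pdivlMr//.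
pose d j t := `|g (t + grid m j.+1) - g (t + grid m j)|.
have shift j : (j < m)%N ->
    segment_integrable 0 m%:R^-1 (fun t => g (t + grid m j)) /\
    Int (grid m j) (grid m j.+1) g = Int 0 m%:R^-1 (fun t => g (t + grid m j)).
  move=> jm; have := @segment_integral_shift _ (grid m j) 0 m%:R^-1 g.
  rewrite add0r [_ + grid m j]addrC -gridS; apply.
  by apply: segment_integrableS ig; [exact: grid_ge0|exact: grid_le1].
have id j : (j < m.-1)%N -> segment_integrable 0 m%:R^-1 (d j).
  move=> jm; have jm' : (j.+1 < m)%N by rewrite -(prednK m0) ltnS.
  apply/segment_integrable_norm/segment_integrableB.
    by case: (shift j.+1).
  by case: (shift j) => //; exact: ltnW.
have isum k : (k <= m.-1)%N -> segment_integrable 0 m%:R^-1 (fun t =>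
  \sum_(0 <= j < k) d j t)
   /\ Int 0 m%:R^-1 (fun t => \sum_(0 <= j < k) d j t) =
     \sum_(0 <= j < k) Int 0 m%:R^-1 (d j).
  elim: k => [|k IH] km.
    have -> : (fun t : R => \sum_(0 <= j < 0) d j t) = (fun=> 0).
      by apply/funext => t; rewrite big_nil.
    split; first exact: segment_integrable_cst.
    by rewrite big_nil segment_Rintegral_cst ?mul0r ?invr_ge0.
  have [i1 e1] := IH (ltnW km).
  have -> : (fun t : R => \sum_(0 <= j < k.+1) d j t) =
            (fun t : R => \sum_(0 <= j < k) d j t + d k t).
    by apply/funext => t; rewrite big_nat_recr.
  split; first by apply: segment_integrableD => //; exact: id.
  rewrite RintegralD//; last exact: id.
  by rewrite e1 big_nat_recr.
have [i1 e1] := isum _ (leqnn _).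
apply: (@le_trans _ _ (Int 0 m%:R^-1 (fun t => \sum_(0 <= j < m.-1) d j t))).
  rewrite e1 !big_nat; apply: ler_sum => j /andP[_ jm].
  have jm' : (j.+1 < m)%N by rewrite -(prednK m0) ltnS.
  have [s1 t1] := shift j.+1 jm'; have [s0 t0] := shift j (ltnW jm').
  have -> : f (grid m j) - 2 * f (grid m j.+1) + f (grid m j.+2) =
    (f (grid m j.+2) - f (grid m j.+1)) - (f (grid m j.+1) - f (grid m j)) by
      ring.
  rewrite !fE ?grid_ge0 ?le_gridS ?grid_le1//; last exact: ltnW.
  rewrite t1 t0 -RintegralB//; apply: le_normr_Rintegral => //.
  exact: segment_integrableB.
apply: (@le_trans _ _ (Int 0 m%:R^-1 (fun=> v 0 1))); last first.
  by rewrite segment_Rintegral_cst ?invr_ge0// subr0.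
apply: le_segment_Rintegral => //; first exact: segment_integrable_cst.
move=> t /andP[t0 tm].
(* The offset is at most one cell, so the nodes up to index [m.-1] stay in [0, 1] after
   translation. *)
have yk : t + grid m m.-1 <= 1.
  rewrite (le_trans (_ : _ <= m%:R^-1 + grid m m.-1)) ?lerD2r//.
  by rewrite addrC -gridS prednK// grid_last.
pose y j := t + grid m j.
have yS j : y j <= y j.+1 by rewrite lerD2l le_gridS.
have y0 : 0 <= y 0%N by rewrite addr_ge0// grid_ge0.
have ynd i j : (i <= j)%N -> y i <= y j.
  by move/nondecreasing_seqP : yS; exact.
have fin a b := @total_variation_fin g a b bvg.
apply: (@le_trans _ _ (\sum_(0 <= j < m.-1) v (y j) (y j.+1))).
  rewrite !big_nat; apply: ler_sum => j /andP[_ jm].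
  have yj1 : y j.+1 <= 1 by apply: le_trans yk; exact: ynd.
  rewrite -lee_fin /v fineK; first exact: total_variation_ge.
  by apply: fin => //; apply: le_trans y0 _; exact: ynd.
rewrite (sum_total_variation bvg yS y0 yk).
have yy := ynd _ _ (leq0n m.-1).
have y0' : y 0%N <= 1 by exact: le_trans yk.
rewrite /v fine_le ?fin//.
  rewrite (total_variationD g y0 y0') (total_variationD g yy yk).
  by rewrite addeCA leeDl// adde_ge0// total_variation_ge0.
Qed.

(** This is [le_Ftilde] for a single cell, where F~ vanishes. *)
Lemma dist_mean_le_half_variation : A <= v 0 1 / 2.
Proof.
have := le_Ftilde (ltn0Sn 0); rewrite Ftilde_grid big_nat1 grid0 grid_last//.
by rewrite divr1 subrr normr0 add0r mulr1.
Qed.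

End representative.

End uniform_grid.

(** * Passing to the minimal variation Var(f') *)

Section V1_bounds.
Context {R : realType}.
Notation mu := (@lebesgue_measure R).
Local Notation TV := (@total_variation R).

(** Representatives of infinite variation satisfy any lower bound, so only those of bounded
    variation need testing. *)
Lemma deriv_var_ge (f : R -> R) (x : R) :
  (forall g, bounded_variation 0 1 g ->
     (\forall t \ae mu, t \in `[0, 1] -> g t = derive1 f t) ->
     x <= fine (TV 0 1 g)) ->
  (x%:E <= deriv_var f)%E.
Proof.
move=> H; apply: le_ereal_inf_tmp => _ [g gf' <-].
have [/bounded_variationP bvg|] := boolP (TV 0 1 g \is a fin_num).
  rewrite -[leRHS]fineK; first by rewrite lee_fin; apply: H => //; exact: bvg.
  by apply/bounded_variationP => //; exact: bvg.
by rewrite ge0_fin_numE ?total_variation_ge0// -leNgt leye_eq => /eqP ->;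
  rewrite leey.
Qed.

Lemma V1_bounds (f : R -> R) : V1 f -> exists V A : R,
  [/\ deriv_var f = V%:E, deriv_dev f = A%:E, 0 <= A, A <= V / 2 &
    forall m : nat, (0 < m)%N ->
    [/\ `|integral01 f - trapezoid m.+1 f| <= V / (8 * m%:R ^+ 2),
        Ftilde m.+1 f <= A, A <= Ftilde m.+1 f + V / (2 * m%:R)
      & Fsecond m.+1 f <= V]].
Proof.
move=> [cf acf Voo].
have V0 : (0%:E <= deriv_var f)%E.
  by apply: deriv_var_ge => g _ _; rewrite fine_ge0// total_variation_ge0.
have VE : deriv_var f = (fine (deriv_var f))%:E.
  by rewrite fineK// ge0_fin_numE.
have [_ [g0 g0f' <-] TVg0] := ereal_inf_lt Voo.
have bvg0 : bounded_variation 0 1 g0.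
  by apply/bounded_variationP => //; rewrite ge0_fin_numE// total_variation_ge0.
have AE := derivative_representative_deriv_dev bvg0 g0f'.
set A := \int[mu]_(t in `[0, 1]) `|g0 t - (f 1 - f 0)| in AE.
have Aeq g : bounded_variation 0 1 g ->
    (\forall t \ae mu, t \in `[0, 1] -> g t = derive1 f t) ->
    A = \int[mu]_(t in `[0, 1]) `|g t - (f 1 - f 0)|.
  move=> bvg gf'; have := derivative_representative_deriv_dev bvg gf'.
  by rewrite AE => -[].
have Vge (x : R) : (forall g, bounded_variation 0 1 g ->
     (\forall t \ae mu, t \in `[0, 1] -> g t = derive1 f t) ->
     (forall a b, 0 <= a -> a <= b -> b <= 1 ->
        f b - f a = \int[mu]_(t in `[a, b]) g t) ->
     x <= fine (TV 0 1 g)) -> x <= fine (deriv_var f).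
  move=> H; rewrite -lee_fin -VE; apply: deriv_var_ge => g bvg gf'.
  by apply: H => //; exact: derivative_representative_integral.
exists (fine (deriv_var f)), A; split => //.
- by apply: Rintegral_ge0.
- rewrite ler_pdivlMr//; apply: Vge => g bvg gf' fE.
  by rewrite -ler_pdivlMr// (Aeq g)//; exact: dist_mean_le_half_variation.
move=> m m0; have mp : 0 < (m%:R : R) by rewrite ltr0n.
split.
- have p0 : 0 < 8 * (m%:R : R) ^+ 2 by rewrite mulr_gt0// exprn_gt0.
  rewrite ler_pdivlMr//; apply: Vge => g bvg gf' fE.
  by rewrite -ler_pdivlMr//; exact: trapezoid_error.
- apply: (Ftilde_le bvg0) => //; exact: derivative_representative_integral.
- have p0 : 0 < 2 * (m%:R : R) by rewrite mulr_gt0.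
  rewrite -lerBlDl ler_pdivlMr//; apply: Vge => g bvg gf' fE.
  by rewrite -ler_pdivlMr// lerBlDl (Aeq g)//; exact: le_Ftilde.
- by apply: Vge => g bvg gf' fE; exact: Fsecond_le.
Qed.

End V1_bounds.

(** * The two algorithms *)

Section algorithm.
Context {R : realType}.
Implicit Types (x eps tau : R) (f : R -> R) (m n : nat).

Lemma ceiln_le x n : 0 <= x -> (ceiln x <= n)%N = (x <= n%:R).
Proof.
move=> x0; rewrite -lez_nat /ceiln gez0_abs; first by rewrite ceil_le_int.
by rewrite ceil_ge0 (lt_le_trans _ x0)// ltrN10.
Qed.

Lemma ge_ceiln x : 0 <= x -> x <= (ceiln x)%:R.
Proof. by move=> x0; rewrite -ceiln_le. Qed.

Lemma ceiln_lt x : 0 <= x -> (ceiln x)%:R < x + 1.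
Proof.
move=> x0; have [->|] := posnP (ceiln x); first by rewrite ltr_wpDl.
case E : (ceiln x) => [//|k] _; rewrite -natr1 ltrD2r ltNge -ceiln_le//.
by rewrite E ltnn.
Qed.

Lemma le_ceiln x y : 0 <= x -> x <= y -> (ceiln x <= ceiln y)%N.
Proof.
move=> x0 xy; rewrite ceiln_le//; apply: (le_trans xy); apply: ge_ceiln.
exact: le_trans xy.
Qed.

Lemma sqrt_le_natE x n : 0 <= x -> (Num.sqrt x <= n%:R) = (x <= n%:R ^+ 2).
Proof.
move=> x0; rewrite -[in LHS](ger0_norm (ler0n R n)) -sqrtr_sqr ler_sqrt//.
Qed.

Lemma error_factor_le (sigma eps : R) m : 0 < sigma -> 0 < eps -> (0 < m)%N ->
  (error_factor m.+1 <= eps / sigma) =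
    (ceiln (Num.sqrt (sigma / (8 * eps))) <= m)%N.
Proof.
move=> s0 e0 m0; have mp : 0 < (m%:R : R) by rewrite ltr0n.
rewrite ceiln_le ?sqrtr_ge0// sqrt_le_natE;
  last by rewrite divr_ge0 ?mulr_ge0 ?ltW.
rewrite /error_factor/= ler_pdivlMr// mulrC ler_pdivrMr ?mulr_gt0 ?exprn_gt0//.
by rewrite ler_pdivrMr ?mulr_gt0//; congr (_ <= _); ring.
Qed.

Lemma nonadaptive_costE (sigma eps : R) (s0 : 0 < sigma) (e0 : 0 < eps) :
  nonadaptive_cost s0 e0 = (ceiln (Num.sqrt (sigma / (8 * eps))) + 1)%N.
Proof.
rewrite /nonadaptive_cost; case: ex_minnP => -[//|m] /andP[m1 mE] mmin.
have m0 : (0 < m)%N by [].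
rewrite addn1; congr S; apply/eqP;
  rewrite eqn_leq -[X in _ && X]error_factor_le// mE andbT.
have x0 : 0 < Num.sqrt (sigma / (8 * eps)) by rewrite sqrtr_gt0 divr_gt0
  ?mulr_gt0.
(* As [sigma] is positive the ceiling is at least 1, so the constraint of at least two nodes does
   not raise the minimum. *)
have c0 : (0 < ceiln (Num.sqrt (sigma / (8 * eps))))%N.
  by rewrite ltnNge ceiln_le ?(ltW x0)// -ltNge.
rewrite -ltnS; apply: mmin; rewrite ltnS c0/= error_factor_le//; exact: leqnn.
Qed.

Lemma nonadaptive_error (sigma eps : R) (s0 : 0 < sigma) (e0 : 0 < eps) f :
  ball_var sigma f -> `|integral01 f - nonadaptive s0 e0 f| <= eps.
Proof.
move=> [/V1_bounds[V [A [VE _ _ _ H]]]]; rewrite VE lee_fin => Vs.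
rewrite /nonadaptive /nonadaptive_cost;
  case: ex_minnP => -[//|m] /andP[m0 mE] _.
have [+ _ _ _] := H m m0; move/le_trans; apply.
move: mE; rewrite /error_factor/= ler_pdivlMr//; apply: le_trans.
by rewrite mulrC ler_wpM2l// invr_ge0 mulr_ge0// sqr_ge0.
Qed.

(** * The adaptive algorithm on the cone *)

Section cone_run.
Variables (eps tau : R) (f : R -> R) (V A : R).
Hypotheses (e0 : 0 < eps) (tau2 : 2 <= tau).
Hypotheses (A0 : 0 <= A) (VA : V <= tau * A).
Hypothesis H : forall m : nat, (0 < m)%N ->
    [/\ `|integral01 f - trapezoid m.+1 f| <= V / (8 * m%:R ^+ 2),
        Ftilde m.+1 f <= A, A <= Ftilde m.+1 f + V / (2 * m%:R)
      & Fsecond m.+1 f <= V].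

Let S := Num.sqrt (tau * A / (8 * eps)).

Let t0 : 0 < tau. Proof. exact: lt_le_trans tau2. Qed.

Let S0 : 0 <= S. Proof. exact: sqrtr_ge0. Qed.

Let Ft0 n : 0 <= Ftilde n f.
Proof. by apply: sumr_ge0 => i _; exact: normr_ge0. Qed.

Let large m : tau + 1 <= 2 * m%:R -> 0 < (m%:R : R) /\ tau < 2 * m%:R.
Proof. by move=> ?; split; move: t0; lra. Qed.

(** After clearing denominators the claim is F (2 m - tau) <= 2 m tau F~. Here F <= V, and 2 m V <=
    2 m tau A <= tau (2 m F~ + V). *)
Lemma tau_min_le m : tau + 1 <= 2 * m%:R -> tau_min f m.+1 <= tau.
Proof.
move=> /large[mp tm]; have m0 : (0 < m)%N by move: mp; rewrite ltr0n.
have [_ _ AF FV] := H m0; rewrite /tau_min.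
have -> : (2 * m.+1%:R - 2 : R) = 2 * m%:R by rewrite -natr1; ring.
have F0 : 0 <= Fsecond m.+1 f.
  by rewrite mulr_ge0// sumr_ge0// => i _; exact: normr_ge0.
set F := Fsecond _ _ in F0 FV *; set Ft := Ftilde _ _ in AF *.
have Ftm : 0 <= Ft by exact: Ft0.
have m2 : 0 < 2 * (m%:R : R) by rewrite mulr_gt0.
have D0 : 0 <= Ft + F / (2 * m%:R) by rewrite addr_ge0// divr_ge0// ltW.
(* With a zero denominator [tau_min] is 0 by the convention on division. *)
move: D0; rewrite le_eqVlt => /predU1P[<-|D0]; first by rewrite invr0 mulr0 ltW.
rewrite ler_pdivrMr// -(ler_pM2r m2).
have -> : tau * (Ft + F / (2 * m%:R)) * (2 * m%:R) =
  tau * (Ft * (2 * m%:R) + F).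
  by field; rewrite gt_eqF.
have AF' : A * (2 * m%:R) <= Ft * (2 * m%:R) + V.
  have -> : Ft * (2 * m%:R) + V = (Ft + V / (2 * m%:R)) * (2 * m%:R).
    by field; rewrite gt_eqF.
  by rewrite ler_pM2r.
have H1 : F * (2 * m%:R - tau) <= V * (2 * m%:R - tau).
  by rewrite ler_pM2r// subr_gt0.
have H2 : V * (2 * m%:R) <= tau * (A * (2 * m%:R)).
  by rewrite [leRHS]mulrA ler_pM2r.
have H3 : tau * (A * (2 * m%:R)) <= tau * (Ft * (2 * m%:R) + V).
  by rewrite ler_pM2l.
lra.
Qed.

Lemma pass_cone m : tau + 1 <= 2 * m%:R -> pass eps f tau m.+1 =
  if Ftilde m.+1 f <= 4 * eps * m%:R * (2 * m%:R - tau) / tau then Stop m.+1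
  else Continue tau (m * maxn 2
       (ceiln (m%:R^-1 * Num.sqrt (tau * Ftilde m.+1 f / (8 * eps))))).+1.
Proof.
move=> tm; rewrite /pass tau_min_le// /stage3.
have -> : (2 * m.+1%:R - 2 : R) = 2 * m%:R by rewrite -natr1; ring.
by have -> : (m.+1%:R - 1 : R) = m%:R by rewrite -natr1 addrK.
Qed.

(** From A <= F~ + V / (2 m) and V <= tau A follows A (2 m - tau) <= 2 m F~; inserting the test, the
    positive factor 2 m - tau cancels. *)
Lemma stop_bound m : tau + 1 <= 2 * m%:R ->
  Ftilde m.+1 f <= 4 * eps * m%:R * (2 * m%:R - tau) / tau ->
  tau * A <= 8 * eps * m%:R ^+ 2.
Proof.
move=> /large[mp tm]; have m0 : (0 < m)%N by move: mp; rewrite ltr0n.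
have [_ _ AF _] := H m0; rewrite ler_pdivlMr// => stop.
have m2 : 0 < 2 * (m%:R : R) by rewrite mulr_gt0.
have AF' : A * (2 * m%:R) <= Ftilde m.+1 f * (2 * m%:R) + V.
  have -> : Ftilde m.+1 f * (2 * m%:R) + V =
    (Ftilde m.+1 f + V / (2 * m%:R)) * (2 * m%:R).
    by field; rewrite gt_eqF.
  by rewrite ler_pM2r.
have dm : 0 < 2 * m%:R - tau by rewrite subr_gt0.
have H1 : tau * (A * (2 * m%:R - tau)) <= tau * (Ftilde m.+1 f * (2 * m%:R)).
  by rewrite ler_pM2l//; move: VA; lra.
rewrite -(ler_pM2r dm).
have H2 : Ftilde m.+1 f * tau * (2 * m%:R) <=
    4 * eps * m%:R * (2 * m%:R - tau) * (2 * m%:R) by rewrite ler_pM2r.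
have -> : 8 * eps * m%:R ^+ 2 * (2 * m%:R - tau) =
    4 * eps * m%:R * (2 * m%:R - tau) * (2 * m%:R) by ring.
lra.
Qed.

Lemma stop_error m : (0 < m)%N -> tau * A <= 8 * eps * m%:R ^+ 2 ->
  `|integral01 f - trapezoid m.+1 f| <= eps.
Proof.
move=> m0 tA; have [+ _ _ _] := H m0; move/le_trans; apply.
rewrite ler_pdivrMr ?mulr_gt0 ?exprn_gt0 ?ltr0n//.
by rewrite (le_trans VA)// (le_trans tA)// -mulrA mulrCA.
Qed.

Lemma next_bound m : tau + 1 <= 2 * m%:R ->
  4 * eps * m%:R * (2 * m%:R - tau) / tau < Ftilde m.+1 f ->
  (m * maxn 2 (ceiln (m%:R^-1 * Num.sqrt (tau * Ftilde m.+1 f / (8 * eps)))))%:R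
    <= 2 * S + tau.
Proof.
move=> /large[mp tm]; have m0 : (0 < m)%N by move: mp; rewrite ltr0n.
have [_ FA _ _] := H m0; rewrite ltr_pdivrMr// => go.
have e8 : 0 < 8 * eps by rewrite mulr_gt0.
set s := Num.sqrt (tau * Ftilde m.+1 f / (8 * eps)).
have s0 : 0 <= s by exact: sqrtr_ge0.
have sS : s <= S.
  by rewrite ler_wsqrtr// ler_pM2r ?invr_gt0// ler_pM2l.
have s2 : s ^+ 2 * (8 * eps) = tau * Ftilde m.+1 f.
  rewrite sqr_sqrtr; first by rewrite divfK// gt_eqF.
  by apply: divr_ge0; [apply: mulr_ge0; [exact: ltW|exact: Ft0]|exact: ltW].
have ms : m%:R * (2 * m%:R - tau) < 2 * s ^+ 2.
  rewrite -(ltr_pM2r (_ : 0 < 4 * eps)) ?mulr_gt0//.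
  have -> : 2 * s ^+ 2 * (4 * eps) = s ^+ 2 * (8 * eps) by ring.
  by rewrite s2; move: go; lra.
(* If the ceiling [c] exceeds 2, then s / m > 2, so m c < s + m < 3 s / 2. Otherwise m is doubled
   and m <= s + tau / 2 has to be shown. *)
have [c2|c2] := leqP (ceiln (m%:R^-1 * s)) 2; rewrite natrM; last first.
  have q0 : 0 <= m%:R^-1 * s by rewrite mulr_ge0// invr_ge0 ltW.
  have c1 := ceiln_lt q0.
  have q1 : m%:R * (m%:R^-1 * s) = s by rewrite mulVKf// gt_eqF.
  have c3 : 3 <= (ceiln (m%:R^-1 * s))%:R :> R by rewrite ler_nat.
  set c := (ceiln _)%:R in c1 c3 *; set q := m%:R^-1 * s in q0 c1 q1.
  have q2 : 2 < q by lra.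
  have H1 : m%:R * c <= m%:R * (q + 1) by rewrite ler_pM2l// ltW.
  have H2 : m%:R * 2 <= m%:R * q by rewrite ler_pM2l// ltW.
  by move: t0 s0 sS H1 H2; rewrite mulrDr q1; lra.
(* If m > s + tau / 2, then m (m - tau / 2) >= m s >= s^2, against the failed test [ms]. *)
have [|] := leP (m%:R : R) (s + tau / 2); first by move: sS; lra.
move=> ms'; have H1 : 0 <= m%:R * (m%:R - tau / 2 - s).
  by rewrite mulr_ge0// ?(ltW mp)//; lra.
have H2 : 0 <= s * (m%:R - s) by rewrite mulr_ge0//; move: t0; lra.
by move: ms H1 H2; rewrite expr2; lra.
Qed.

(* k is fuel: each further pass at least doubles m, which stays below B. *)
Lemma adaptive_run_exists (B : R) m k : 2 * S + tau <= B ->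
  tau + 1 <= 2 * m%:R -> m%:R <= B -> B <= m%:R + k%:R ->
  exists M : nat, [/\ adaptive_run eps f tau m.+1 M.+1, (m <= M)%N, M%:R <= B &
    tau * A <= 8 * eps * M%:R ^+ 2].
Proof.
move=> SB; elim: k m => [|k IH] m tm mB Bk; have := pass_cone tm;
  case: leP => [stop|go] pE.
- by exists m; split=> //; [exact: Run_stop|exact: stop_bound].
(* Without fuel B <= m, yet the next value is at least 2 m and at most B, which is absurd for
   positive m. *)
- have := next_bound tm go; set m' := (m * _)%N in pE * => m'S.
  have [mp _] := large tm.
  have m2 : (m * 2 <= m')%N by rewrite leq_mul2l leq_maxl orbT.
  have : m%:R * 2 <= m'%:R :> R by rewrite -natrM ler_nat.
  by move: Bk; rewrite addr0; lra.
- by exists m; split=> //; [exact: Run_stop|exact: stop_bound].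
- have := next_bound tm go; set m' := (m * _)%N in pE * => m'S.
  have [mp _] := large tm.
  have m2 : (m * 2 <= m')%N by rewrite leq_mul2l leq_maxl orbT.
  have m2' : m%:R * 2 <= m'%:R :> R by rewrite -natrM ler_nat.
  have m1 : 1 <= m%:R :> R by rewrite ler1n; move: mp; rewrite ltr0n.
  have [|||M [run mM MB tA]] := IH m'.
  + by move: mp; lra.
  + exact: le_trans m'S SB.
  + by move: Bk; rewrite -natr1; lra.
  exists M; split => //; first exact: Run_continue pE run.
  by apply: leq_trans mM; apply: leq_trans m2; rewrite muln2 -addnn leq_addr.
Qed.

End cone_run.

Lemma adaptive_costE tau eps f N : adaptive_stops tau eps f N ->
  adaptive_cost tau eps f = N%:R%:E.
Proof.
move=> stops; rewrite /adaptive_cost -(ereal_inf1 N%:R%:E); congr ereal_inf.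
apply/seteqP; split => [_ [N' stops' <-]|_ ->]; last by exists N.
by rewrite (adaptive_run_unique stops stops').
Qed.

Lemma sqrt4 (x : R) : 0 <= x -> 2 * Num.sqrt x = Num.sqrt (4 * x).
Proof.
move=> x0; have -> : 4 * x = 2 ^+ 2 * x by ring.
by rewrite sqrtrM ?sqr_ge0// sqrtr_sqr ger0_norm.
Qed.

Lemma adaptive_cone (tau eps : R) f : 2 <= tau -> 0 < eps -> cone tau f ->
  let V := fine (deriv_var f) in
  let A := fine (deriv_dev f) in
  exists N : nat,
    [/\ adaptive_stops tau eps f N, adaptive_cost tau eps f = N%:R%:E,
        `|integral01 f - trapezoid N f| <= eps,
        (maxn (ceiln ((tau + 1) / 2)) (ceiln (Num.sqrt (V / (8 * eps)))) + 1
         <= maxn (ceiln ((tau + 1) / 2))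
                 (ceiln (Num.sqrt (tau * A / (8 * eps)))) + 1 <= N)%N
      & N%:R <= Num.sqrt (tau * A / (2 * eps)) + tau + 4
             <= Num.sqrt (tau * V / (4 * eps)) + tau + 4].
Proof.
move=> tau2 e0 [/V1_bounds[V [A [VE AE A0 AV H]]]];
  rewrite VE AE -EFinM lee_fin => VA /=.
have t0 : 0 < tau by exact: lt_le_trans tau2.
have V0 : 0 <= V by move: A0 AV; lra.
have tA0 : 0 <= tau * A by rewrite mulr_ge0// ltW.
have tq0 : 0 <= (tau + 1) / 2 by move: t0; lra.
have e8 : 0 < 8 * eps by rewrite mulr_gt0.
have S2 : Num.sqrt (tau * A / (2 * eps)) = 2 * Num.sqrt (tau * A / (8 * eps)).
  rewrite sqrt4; last by rewrite divr_ge0// ltW.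
  by congr Num.sqrt; field; rewrite gt_eqF.
set S := Num.sqrt (tau * A / (8 * eps)) in S2.
have S0 : 0 <= S by exact: sqrtr_ge0.
pose m := ceiln ((tau + 1) / 2).
have tm : tau + 1 <= 2 * m%:R by have := ge_ceiln tq0; rewrite -/m; lra.
(* The 3 makes room for the initial m, which is below (tau + 3) / 2; passing from cells to nodes
   turns it into the 4 of the cost bound. *)
pose B := 2 * S + tau + 3.
have mB : m%:R <= B by have := ceiln_lt tq0; rewrite -/m /B; move: t0 S0; lra.
have SB : 2 * S + tau <= B by rewrite /B; lra.
have Bk : B <= m%:R + (ceiln B)%:R.
  by rewrite (le_trans (@ge_ceiln B _)) ?lerDr// /B; move: t0 S0; lra.
have [M [run mM MB tAM]] := adaptive_run_exists e0 tau2 VA H SB tm mB Bk.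
have M0 : (0 < M)%N.
  apply: leq_trans mM; rewrite ltnNge; apply/negP; rewrite leqn0 => /eqP m0.
  by move: tm; rewrite m0 mulr0; move: t0; lra.
have stops : adaptive_stops tau eps f M.+1 by rewrite /adaptive_stops addn1.
exists M.+1; split => //.
- exact: adaptive_costE.
- exact: (@stop_error eps tau f V A).
- rewrite !addn1 !ltnS; apply/andP; split.
    have VS : Num.sqrt (V / (8 * eps)) <= S.
      by rewrite ler_wsqrtr// ler_pM2r ?invr_gt0.
    by rewrite geq_max leq_maxl/= leq_max (le_ceiln _ VS) ?sqrtr_ge0 ?orbT.
  rewrite geq_max mM/= ceiln_le ?sqrtr_ge0//
    sqrt_le_natE ?(divr_ge0 tA0 (ltW e8))//.
  by rewrite ler_pdivrMr// [leRHS]mulrC.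
- rewrite S2 -natr1; apply/andP; split; first by move: MB; rewrite /B; lra.
  rewrite -S2 !lerD2r ler_wsqrtr//.
  have -> : tau * V / (4 * eps) = tau * (V / 2) / (2 * eps) by field;
    rewrite gt_eqF.
  by rewrite ler_pM2r ?invr_gt0 ?mulr_gt0// ler_pM2l.
Qed.

End algorithm.

(** * Computational stability *)

Section stability.
Context {R : realType}.
Implicit Types (x eps tau : R) (f : R -> R).

(** The denominator dominates both [S] and 1, which absorb [p * S] and [q] respectively. An infinite
    [Y], as for an empty infimum, makes the quotient 0. *)
Lemma dive_max_le (X Y : \bar R) (p q S : R) : 0 <= p -> 0 <= q ->
  (X <= (p * S + q)%:E)%E -> (S%:E <= Y)%E -> (X / maxe 1 Y <= (p + q)%:E)%E.
Proof.
move=> p0 q0 XS SY; set Z := (X in (_ / X)%E).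
have : (S%:E <= Z)%E by rewrite le_max SY orbT.
have : (1%:E <= Z)%E by rewrite le_max lexx.
case: {SY} Z => [r| |] //=; last by rewrite invey mule0 lee_fin addr_ge0.
rewrite !lee_fin => r1 Sr; have r0 : 0 < r by exact: lt_le_trans r1.
rewrite inver gt_eqF//; apply: (@le_trans _ _ ((p * S + q)%:E * r^-1%:E)%E).
  by apply: lee_wpmul2r => //; rewrite lee_fin invr_ge0 ltW.
rewrite -EFinM lee_fin ler_pdivrMr// mulrDl lerD ?ler_wpM2l//.
by rewrite ler_peMr.
Qed.

Lemma stable_of_bounds tau (seminorm : (R -> R) -> \bar R) (p q : R)
    (S : R -> R -> R) : 0 <= p -> 0 <= q ->
  (forall eps s f, 0 < eps -> 0 < s -> cone tau f -> (seminorm f <= s%:E)%E ->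
     (adaptive_cost tau eps f <= (p * S eps s + q)%:E)%E) ->
  (forall eps s f, 0 < eps -> 0 < s -> cone tau f -> (s%:E <= seminorm f)%E ->
     ((S eps s)%:E <= adaptive_cost tau eps f)%E) ->
  computationally_stable tau seminorm.
Proof.
move=> p0 q0 ub lb; apply: (@le_lt_trans _ _ (p + q)%:E); last exact: ltry.
apply: ge_ereal_sup => _ [[eps s] /= [e0 s0] <-].
apply: (@dive_max_le _ _ p q (S eps s)) => //.
  by apply: ge_ereal_sup => _ [f [/= cf fs] <-]; exact: ub.
by apply: le_ereal_inf_tmp => _ [f [/= cf fs] <-]; exact: lb.
Qed.

Let cost_ge tau eps f : 2 <= tau -> 0 < eps -> cone tau f ->
  exists2 N : nat, adaptive_cost tau eps f = N%:R%:E &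
  [/\ Num.sqrt (fine (deriv_var f) / (8 * eps)) <= N%:R,
      Num.sqrt (tau * fine (deriv_dev f) / (8 * eps)) <= N%:R,
      N%:R <= Num.sqrt (tau * fine (deriv_dev f) / (2 * eps)) + tau + 4 &
      N%:R <= Num.sqrt (tau * fine (deriv_var f) / (4 * eps)) + tau + 4].
Proof.
move=> tau2 e0 cf; have [N [_ cN _ /andP[VA AN] /andP[N1 N2]]] :=
  adaptive_cone tau2 e0 cf.
exists N => //; split => //; last exact: le_trans N2.
- rewrite -ceiln_le ?sqrtr_ge0//; apply: leq_trans (leq_trans VA AN).
  by rewrite addn1 ltnW// ltnS leq_maxr.
- rewrite -ceiln_le ?sqrtr_ge0//; apply: leq_trans AN.
  by rewrite addn1 ltnW// ltnS leq_maxr.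
Qed.

Let seminorms_fine f : V1 f -> deriv_var f = (fine (deriv_var f))%:E /\
  deriv_dev f = (fine (deriv_dev f))%:E.
Proof. by move=> /V1_bounds[V [A [-> -> _ _ _]]]. Qed.

Lemma stable_deriv_dev tau : 2 <= tau ->
  computationally_stable tau (@deriv_dev R).
Proof.
move=> tau2; have t0 : 0 < tau by exact: lt_le_trans tau2.
apply: (@stable_of_bounds _ _ 2 (tau + 4)
  (fun eps s => Num.sqrt (tau * s / (8 * eps)))) => //.
- by rewrite addr_ge0// ltW.
- move=> eps s f e0 s0 cf; have [_ ->] := seminorms_fine cf.1;
  rewrite lee_fin => As.
  have [N -> [_ _ NA _]] := cost_ge tau2 e0 cf.
  rewrite lee_fin addrA; apply: (le_trans NA); rewrite !lerD2r.
  rewrite sqrt4; last by rewrite divr_ge0 ?mulr_ge0 ?(ltW e0) ?(ltW s0) ?(ltW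
    t0).
  have -> : 4 * (tau * s / (8 * eps)) = tau * s / (2 * eps) by field;
    rewrite gt_eqF.
  by rewrite ler_wsqrtr// ler_pM2r ?invr_gt0 ?mulr_gt0// ler_pM2l.
- move=> eps s f e0 s0 cf; have [_ ->] := seminorms_fine cf.1;
  rewrite lee_fin => sA.
  have [N -> [_ NA _ _]] := cost_ge tau2 e0 cf.
  rewrite lee_fin; apply: le_trans NA.
  by rewrite ler_wsqrtr// ler_pM2r ?invr_gt0 ?mulr_gt0// ler_pM2l.
Qed.

Lemma stable_deriv_var tau : 2 <= tau ->
  computationally_stable tau (@deriv_var R).
Proof.
move=> tau2; have t0 : 0 < tau by exact: lt_le_trans tau2.
(* sqrt(2 tau) is the ratio of the roots sqrt(tau s / (4 eps)) and sqrt(s / (8 eps)) in the upper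
   and lower cost bounds. *)
apply: (@stable_of_bounds _ _ (Num.sqrt (2 * tau)) (tau + 4)
  (fun eps s => Num.sqrt (s / (8 * eps)))) => //.
- by rewrite addr_ge0// ltW.
- move=> eps s f e0 s0 cf; have [-> _] := seminorms_fine cf.1;
  rewrite lee_fin => Vs.
  have [N -> [_ _ _ NV]] := cost_ge tau2 e0 cf.
  rewrite lee_fin addrA; apply: (le_trans NV); rewrite !lerD2r.
  rewrite -sqrtrM; last by rewrite mulr_ge0// ltW.
  have -> : 2 * tau * (s / (8 * eps)) = tau * s / (4 * eps) by field;
    rewrite gt_eqF.
  by rewrite ler_wsqrtr// ler_pM2r ?invr_gt0 ?mulr_gt0// ler_pM2l.
- move=> eps s f e0 s0 cf; have [-> _] := seminorms_fine cf.1;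
  rewrite lee_fin => sV.
  have [N -> [NV _ _ _]] := cost_ge tau2 e0 cf.
  rewrite lee_fin; apply: le_trans NV.
  by rewrite ler_wsqrtr// ler_pM2r ?invr_gt0 ?mulr_gt0.
Qed.

End stability.

Theorem theorem7 (R : realType) :
  (forall (sigma eps : R) (sigma0 : 0 < sigma) (eps0 : 0 < eps),
     (forall f : R -> R, ball_var sigma f ->
        `|integral01 f - nonadaptive sigma0 eps0 f| <= eps)
     /\ nonadaptive_cost sigma0 eps0
        = (ceiln (Num.sqrt (sigma / (8 * eps))) + 1)%N)
  /\
  (forall tau : R, 2 <= tau ->
     [/\ forall (eps : R) (f : R -> R), 0 < eps -> cone tau f ->
           let V := fine (deriv_var f) in
           let A := fine (deriv_dev f) in
           exists N : nat,
             [/\ adaptive_stops tau eps f N,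
                 adaptive_cost tau eps f = N%:R%:E,
                 `|integral01 f - trapezoid N f| <= eps,
                 (maxn (ceiln ((tau + 1) / 2))
                       (ceiln (Num.sqrt (V / (8 * eps)))) + 1
                  <= maxn (ceiln ((tau + 1) / 2))
                       (ceiln (Num.sqrt (tau * A / (8 * eps)))) + 1
                  <= N)%N
               & N%:R <= Num.sqrt (tau * A / (2 * eps)) + tau + 4
                      <= Num.sqrt (tau * V / (4 * eps)) + tau + 4],
         computationally_stable tau deriv_dev
       & computationally_stable tau deriv_var]).
Proof.
split=> [sigma eps sigma0 eps0|tau tau2].
  by split; [exact: nonadaptive_error|exact: nonadaptive_costE].
split; last 2 first.
- exact: stable_deriv_dev.
- exact: stable_deriv_var.
by move=> eps f eps0 cf; exact: adaptive_cone.
Qed.
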